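(* Let $\mu,\nu$ be probability measures on $\mathcal{X}$ with $\mu\ll\nu$. Assume that the measurement channel is continuous in total variation (whenever $a_n\to a$ in $\mathcal{X}$, $\|h_{a_n}Q-h_aQ\|_{TV}\to0$) and that the model is observable. Then for every $f\in C_b(\mathcal{X})$, $\lim_{n\to\infty}E^\mu\left[\left|\int f\,d\pi_n^\mu-\int f\,d\pi_n^\nu\right|\right]=0$.
   Context: Setting: $\mathcal{X},\mathcal{Y},\mathcal{Z}$ are Polish spaces. $T$ is a transition kernel on $\mathcal{X}$; $\{Z_n\}$ is i.i.d. with law $Q$, independent of the states; $h:\mathcal{X}\times\mathcal{Z}\to\mathcal{Y}$ measurable, $h_x=h(x,\cdot)$, $h_xQ$ the pushforward of $Q$ under $h_x$. $\{X_n\}$ is a Markov chain with kernel $T$, $X_0\sim\mu$, $Y_n=h(X_n,Z_n)$; $P^\mu$, $E^\mu$ are joint law and expectation. Filter $\pi_n^{\mu}=P^{\mu}(X_n\in\cdot\mid Y_0,\dots,Y_n)$. $\|P-R\|_{TV}=\sup_{\|f\|_\infty\le1}|\int f\,dP-\int f\,dR|$. For $N\in\mathbb{N}$ let $P(dy_{[1,N]}\mid X_1=x)$ be the conditional law of $(Y_1,\dots,Y_N)$ given $X_1=x$. The model is observable if for some $N$, for every $f\in C_b(\mathcal{X})$ and $\epsilon>0$ there is a bounded measurable $g:\mathcal{Y}^N\to\mathbb{R}$ with $\sup_x|f(x)-\int g(y_{[1,N]})P(dy_{[1,N]}\mid X_1=x)|<\epsilon$. *)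

(* Defs.v *)
From HB Require Import structures.
From mathcomp Require Import all_boot all_order all_algebra.
From mathcomp Require Import all_classical all_reals all_analysis measurable_realfun.
Set Implicit Arguments. Unset Strict Implicit. Unset Printing Implicit Defensive.
Import Order.TTheory GRing.Theory Num.Theory.
Import numFieldNormedType.Exports.
Local Open Scope classical_set_scope.
Local Open Scope ring_scope.

Definition polish (R : realType) (T : topologicalType) : Prop :=
  (exists D : set T, countable D /\ closure D = setT) /\
  exists dist : T -> T -> R,
    [/\ (forall x y, dist x y = 0 <-> x = y),
        (forall x y, dist x y = dist y x),
        (forall x y z, dist x z <= dist x y + dist y z),
        (forall A : set T, open A <->
            forall x, A x -> exists2 e : R, 0 < e & [set y | dist x y < e] `<=` A) &
        (forall u : nat -> T,
            (forall e : R, 0 < e -> exists N, forall m n, (N <= m)%N -> (N <= n)%N ->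
               dist (u m) (u n) < e) ->
            exists x, forall e : R, 0 < e -> exists N, forall n, (N <= n)%N ->
               dist (u n) x < e)].

Definition borel (T : ptopologicalType) := g_sigma_algebraType (@open T).

Definition cyl {d} (Y : measurableType d) (n : nat) : set (set (nat -> Y)) :=
  [set A | exists B : nat -> set Y, (forall i, measurable (B i)) /\
           A = [set y | forall i, (i < n)%N -> B i (y i)]].
Arguments cyl {d} Y n.
Notation obs Y n := (g_sigma_algebraType (cyl Y n)).

Local Open Scope ereal_scope.

Section hmm.
Context (R : realType) (X Y Z : ptopologicalType).
Variables (T : R.-pker (borel X) ~> (borel X)) (Q : probability (borel Z) R)
          (h : X -> Z -> Y).

Fixpoint chain_int (n : nat) (A : nat -> set (borel X)) (x : borel X) : \bar R :=
  match n with
  | 0 => (\1_(A 0%N) x)%:E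
  | m.+1 => (\1_(A 0%N) x)%:E * \int[T x]_y chain_int m (fun i => A i.+1) y
  end.

(* (Xs, Zs) on (Om, P): Xs is a Markov chain with kernel T and X_0 ~ mu,
   Zs is i.i.d. with law Q and independent of Xs -- stated through the joint
   finite-dimensional distributions on measurable rectangles. *)
Definition hmm_process d (Om : measurableType d) (P : probability Om R)
    (mu : probability (borel X) R) (Xs : nat -> Om -> X) (Zs : nat -> Om -> Z) : Prop :=
  [/\ (forall n, measurable_fun setT (Xs n : Om -> borel X)),
      (forall n, measurable_fun setT (Zs n : Om -> borel Z)) &
      forall n (A : nat -> set (borel X)) (C : nat -> set (borel Z)),
        (forall i, measurable (A i)) -> (forall i, measurable (C i)) ->
        P [set w | forall i, (i <= n)%N -> A i (Xs i w) /\ C i (Zs i w)] =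
        (\prod_(i < n.+1) Q (C i)) * \int[mu]_x chain_int n A x].

Definition obsseq d (Om : measurableType d) (Xs : nat -> Om -> X) (Zs : nat -> Om -> Z)
  (w : Om) : nat -> Y := fun k => h (Xs k w) (Zs k w).

(* F is a version of the filter: F n (y_0,...,y_n,...) = P(X_n \in . | Y_0..Y_n),
   i.e. a regular conditional distribution of X_n given sigma(Y_0,...,Y_n). *)
Definition is_filter d (Om : measurableType d) (P : probability Om R)
    (Xs : nat -> Om -> X) (Zs : nat -> Om -> Z)
    (F : nat -> (nat -> Y) -> probability (borel X) R) : Prop :=
  forall n,
    (forall A : set (borel X), measurable A ->
       measurable_fun setT (fun y : obs (borel Y) n.+1 => F n y A)) /\
    (forall (A : set (borel X)) (B : set (obs (borel Y) n.+1)),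
       measurable A -> measurable B ->
       P ((Xs n @^-1` A) `&` (obsseq Xs Zs @^-1` B)) =
       \int[P]_(w in obsseq Xs Zs @^-1` B) F n (obsseq Xs Zs w) A).

Definition TV (m1 m2 : set (borel Y) -> \bar R) : \bar R :=
  ereal_sup [set `| \int[m1]_y (f y)%:E - \int[m2]_y (f y)%:E |
            | f in [set f : borel Y -> R | measurable_fun setT f /\
                                           forall y, (`|f y| <= 1)%R]].

Definition tv_continuous_channel : Prop :=
  forall (a : nat -> X) (a0 : X), a n @[n --> \oo] --> a0 ->
    TV (pushforward Q (h (a n) : borel Z -> borel Y))
       (pushforward Q (h a0 : borel Z -> borel Y)) @[n --> \oo] --> 0.

Definition ycons (y : Y) (ys : nat -> Y) : nat -> Y :=
  fun i => if i is j.+1 then ys j else y.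

(* cond_obs N G x = \int G(y_1,...,y_N) P(dy_[1,N] | X_1 = x), the path
   (y_1,...,y_N) being stored in coordinates 0..N-1 (later ones are filler). *)
Fixpoint cond_obs (N : nat) (G : (nat -> Y) -> \bar R) (x : X) : \bar R :=
  match N with
  | 0 => G (fun _ => point)
  | M.+1 => \int[Q]_z \int[T x]_x' cond_obs M (fun ys => G (ycons (h x z) ys)) x'
  end.

Definition observable : Prop :=
  exists N : nat, forall f : X -> R, continuous f -> (exists M, forall x, (`|f x| <= M)%R) ->
    forall eps : R, (0 < eps)%R ->
      exists g : obs (borel Y) N -> R,
        [/\ measurable_fun setT g, (exists M, forall y, (`|g y| <= M)%R) &
            ereal_sup (range (fun x => `| (f x)%:E - cond_obs N (fun y => (g y)%:E) x |))
              < eps%:E].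

End hmm.

(* Main.v *)
Require Import Defs.
From HB Require Import structures.
From mathcomp Require Import all_boot all_order all_algebra.
From mathcomp Require Import all_classical all_reals all_analysis measurable_realfun giry.
From mathcomp Require Import ring lra.
Set Implicit Arguments. Unset Strict Implicit. Unset Printing Implicit Defensive.
Import Order.TTheory GRing.Theory Num.Theory.
Import numFieldNormedType.Exports.
Local Open Scope classical_set_scope.
Local Open Scope ring_scope.

(** Let rho be a bounded approximation of dmu/dnu in L1(nu).  Among the bounded functions
    of finitely many observations, pick Lam nearly minimizing the L2(P^nu) distance to
    rho(X_0).  Perturbing Lam shows that the weight U = rho(X_0) - Lam is almost orthogonal
    to every bounded function of finitely many observations; this plays the role of the
    merging of the observation laws.  If s is the sign of the difference of the filters at
    f, then E^mu|pi_n^mu f - pi_n^nu f| is close to E^nu[U s(Y_0..Y_n) f(X_n)]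
    = E^nu[U phi(X_n)], where phi(x) = f(x) E[s(Y_0..Y_{n-1}, Y_n) | Y_0..Y_{n-1}, X_n = x].
    By total variation continuity the functions phi lie in one bounded equicontinuous
    family, so phi is uniformly close to sum_k phi(x_k) psi_k for a fixed locally finite
    partition of unity (psi_k).  Each sum +-psi_k is continuous and bounded, hence by
    observability close to x |-> E[g(Y_1..Y_N) | X_1 = x] with g bounded, and a
    gliding-hump argument bounds g uniformly over all choices of the signs beyond some rank.
    Writing the coefficients phi(x_k) as mixtures of signs, E^nu[U phi(X_n)] becomes an
    integral of U against bounded functions of the observations, which is small. *)

(** * Integrals of bounded measurable functions *)

(** The obstacle is uniformity. The functions phi change with n and with the observed past, [X] is
    not assumed compact, and observability gives neither a bound on g nor a choice of g linear in f.
    Yet the error left by the near orthogonality of U is eta times a sup norm of g, so that norm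
    must be controlled before eta, and with it Lam, is chosen. Hence the order of choices: eps; the
    partition, which involves f, [Q], [h] and eps but neither n nor s; the initial sign pattern and
    the bounds on g; then rho, eta and Lam; only then n. The rank L at which sums over the partition
    are cut may depend on n, since it enters the bound only through a residual whose integral tends
    to 0. Signs are used because the sign patterns form a Baire space, where one integer bound must
    serve a dense subset of some cylinder, while finitely many sign patterns already recover all
    coefficients in [-1, 1] by averaging. Lam is needed because the filter for nu has its defining
    property only under P^nu and against functions of the observations: rho(X_0) is not such a
    function, Lam is one. *)

Definition bmf d (T : measurableType d) (R : realType) (f : T -> R) :=
  measurable_fun setT f /\ exists M, forall x, `|f x| <= M.

Section bmf_closure.
Context d (T : measurableType d) (R : realType).
Implicit Types f g : T -> R.

Lemma bmf_le f (C : R) : measurable_fun setT f -> (forall x, `|f x| <= C) -> bmf f.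
Proof. by move=> mf fC; split => //; exists C. Qed.

Lemma bmf_cst (c : R) : bmf (fun _ : T => c).
Proof. by split => //; exists `|c|. Qed.

Lemma bmfD f g : bmf f -> bmf g -> bmf (fun x => f x + g x).
Proof.
move=> [mf [A fA]] [mg [B gB]]; split; first exact: measurable_funD.
by exists (A + B) => x; rewrite (le_trans (ler_normD _ _))// lerD.
Qed.

Lemma bmfN f : bmf f -> bmf (fun x => - f x).
Proof.
move=> [mf [A fA]]; split; first exact: measurableT_comp.
by exists A => x; rewrite normrN.
Qed.

Lemma bmfB f g : bmf f -> bmf g -> bmf (fun x => f x - g x).
Proof. by move=> bf bg; apply: bmfD => //; exact: bmfN. Qed.

Lemma bmfM f g : bmf f -> bmf g -> bmf (fun x => f x * g x).
Proof.
move=> [mf [A fA]] [mg [B gB]]; split; first exact: measurable_funM.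
by exists (A * B) => x; rewrite normrM ler_pM.
Qed.

Lemma bmfZ (c : R) f : bmf f -> bmf (fun x => c * f x).
Proof. by move=> bf; apply: bmfM => //; exact: bmf_cst. Qed.

Lemma bmf_norm f : bmf f -> bmf (fun x => `|f x|).
Proof.
move=> [mf [A fA]]; split; first exact: measurableT_comp.
by exists A => x; rewrite normr_id.
Qed.

Lemma bmf_sum (I : Type) (s : seq I) (P : pred I) (F : I -> T -> R) :
  (forall i, P i -> bmf (F i)) -> bmf (fun x => \sum_(i <- s | P i) F i x).
Proof.
move=> bF; elim: s => [|i s IH].
  by rewrite (_ : (fun _ => _) = cst 0); [exact: bmf_cst|apply/funext => x; rewrite big_nil].
rewrite (_ : (fun _ => _) = (fun x => if P i then F i x + \sum_(j <- s | P j) F j x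
    else \sum_(j <- s | P j) F j x)); last first.
  by apply/funext => x; rewrite big_cons.
by have := bF i; case: (P i) => // bFi; apply: bmfD => //; exact: bFi.
Qed.

Lemma bmf_prod (I : Type) (s : seq I) (F : I -> T -> R) :
  (forall i, bmf (F i)) -> bmf (fun x => \prod_(i <- s) F i x).
Proof.
move=> bF; elim: s => [|i s IH].
  by rewrite (_ : (fun _ => _) = cst 1); [exact: bmf_cst|apply/funext => x; rewrite big_nil].
rewrite (_ : (fun _ => _) = (fun x => F i x * \prod_(j <- s) F j x)); last first.
  by apply/funext => x; rewrite big_cons.
exact: bmfM.
Qed.

Lemma bmf_indic (A : set T) : measurable A -> bmf (\1_A : T -> R).
Proof.
move=> mA; split; first exact: measurable_indic.
by exists 1 => x; rewrite indicE; case: (_ \in _); rewrite ?normr1 ?normr0.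
Qed.

End bmf_closure.

Lemma bmf_comp d (T : measurableType d) d' (T' : measurableType d') (R : realType)
  (f : T -> R) (u : T' -> T) : measurable_fun setT u -> bmf f -> bmf (fun x => f (u x)).
Proof.
move=> mu [mf [A fA]]; split; first exact: measurableT_comp.
by exists A.
Qed.

Section bounded_integral.
Context d (T : measurableType d) (R : realType) (m : {finite_measure set T -> \bar R}).
Implicit Types f g : T -> R.

Lemma bmf_integrable f : bmf f -> m.-integrable setT (EFin \o f).
Proof.
move=> [mf [M fM]]; apply: measurable_bounded_integrable => //.
  by rewrite -ge0_fin_numE//; exact: fin_num_measure.
by exists M; split; rewrite ?num_real // => A MA x _; exact: le_trans (fM x) (ltW MA).
Qed.

Lemma bmf_EFin f : bmf f -> (\int[m]_x (f x)%:E)%E = (\int[m]_x f x)%:E.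
Proof.
move=> bf; rewrite /Rintegral fineK//.
exact/integrable_fin_num/bmf_integrable.
Qed.

Lemma bintD f g : bmf f -> bmf g ->
  \int[m]_x (f x + g x) = \int[m]_x f x + \int[m]_x g x.
Proof. by move=> bf bg; apply: RintegralD => //; exact: bmf_integrable. Qed.

Lemma bintB f g : bmf f -> bmf g ->
  \int[m]_x (f x - g x) = \int[m]_x f x - \int[m]_x g x.
Proof. by move=> bf bg; apply: RintegralB => //; exact: bmf_integrable. Qed.

Lemma bintZ c f : bmf f -> \int[m]_x (c * f x) = c * \int[m]_x f x.
Proof. by move=> bf; apply: RintegralZl => //; exact: bmf_integrable. Qed.

Lemma bint_sum (I : Type) (s : seq I) (P : pred I) (F : I -> T -> R) :
  (forall i, P i -> bmf (F i)) ->
  \int[m]_x (\sum_(i <- s | P i) F i x) = \sum_(i <- s | P i) \int[m]_x F i x.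
Proof.
move=> bF; elim: s => [|i s IH].
  rewrite big_nil; under eq_Rintegral do rewrite big_nil.
  by rewrite Rintegral_cst// mul0r.
rewrite big_cons; under eq_Rintegral do rewrite big_cons.
by case: ifPn => // Pi; rewrite bintD ?IH//; [exact: bF|exact: bmf_sum].
Qed.

Lemma ler_bint f g : bmf f -> bmf g -> (forall x, f x <= g x) ->
  \int[m]_x f x <= \int[m]_x g x.
Proof. by move=> bf bg fg; apply: le_Rintegral => //; exact: bmf_integrable. Qed.

Lemma ler_norm_bint f g : bmf f -> bmf g -> (forall x, `|f x| <= g x) ->
  `|\int[m]_x f x| <= \int[m]_x g x.
Proof.
move=> bf bg fg; apply: (le_trans (le_normr_Rintegral _ _)) => //.
  exact: bmf_integrable.
by apply: ler_bint => //; exact: bmf_norm.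
Qed.

End bounded_integral.

Lemma bint_cst d (T : measurableType d) (R : realType) (P : probability T R) (c : R) :
  \int[P]_x c = c.
Proof. rewrite Rintegral_cst// -[RHS]mulr1; congr (c * _).
by have /(congr1 fine) := @probability_setT _ _ _ P. Qed.

Lemma ler_norm_bintP d (T : measurableType d) (R : realType) (P : probability T R)
    (f : T -> R) (C : R) :
  measurable_fun setT f -> (forall x, `|f x| <= C) -> `|\int[P]_x f x| <= C.
Proof.
move=> mf fC; rewrite -[leRHS](bint_cst P); apply: ler_norm_bint => //.
  exact: bmf_le fC.
exact: bmf_cst.
Qed.

Section kernel_integral.
Context d1 (S : measurableType d1) d2 (T : measurableType d2) (R : realType).
Variable k : S -> {finite_measure set T -> \bar R}.
Hypothesis mk : forall U, measurable U -> measurable_fun setT (fun x => k x U).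
Hypothesis kC : exists C : R, forall x, fine (k x setT) <= C.

Let shift (f : T -> R) : bmf f -> exists2 M, 0 <= M & forall y, 0 <= f y + M.
Proof.
move=> [_ [M fM]]; exists `|M| => // y.
have := le_trans (fM y) (ler_norm M); rewrite ler_norml; lra.
Qed.

Let shiftE (f : T -> R) M x : bmf f ->
  \int[k x]_y f y = \int[k x]_y (f y + M) - \int[k x]_y M.
Proof. by move=> bf; rewrite bintD ?addrK//; exact: bmf_cst. Qed.

Let bmf_kint_ge0 (f : T -> R) : bmf f -> (forall y, 0 <= f y) ->
  bmf (fun x => \int[k x]_y f y).
Proof.
move=> bf f0; have [mf [A fA]] := bf; have [C kCx] := kC; split.
  apply: (@measurableT_comp _ _ _ _ _ _ fine _ (fun x => \int[k x]_y (f y)%:E)%E) => //.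
  by apply: measurable_fun_integral_kernel => //; exact/measurable_EFinP.
exists (`|A| * C) => x; apply: (@le_trans _ _ (\int[k x]_y `|A|)).
  apply: ler_norm_bint => // [|y]; first exact: bmf_cst.
  exact: le_trans (fA y) (ler_norm A).
by rewrite Rintegral_cst//; apply: ler_wpM2l; [exact: normr_ge0|exact: kCx].
Qed.

Lemma bmf_kint (f : T -> R) : bmf f -> bmf (fun x => \int[k x]_y f y).
Proof.
move=> bf; have [M M0 fM] := shift bf.
rewrite (funext (fun x => shiftE M x bf)).
by apply: bmfB; apply: bmf_kint_ge0 => //; [apply: bmfD => //|]; exact: bmf_cst.
Qed.

(** Adding a constant [M] makes a bounded [f] nonnegative; the identity then holds for [f + M] and
    for [M], and the constant is cancelled. *)
Lemma bint_mixture (l : {finite_measure set S -> \bar R})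
    (m : {finite_measure set T -> \bar R}) :
  (forall f : T -> \bar R, measurable_fun setT f -> (forall y, 0 <= f y)%E ->
     \int[m]_y f y = \int[l]_x \int[k x]_y f y)%E ->
  forall f : T -> R, bmf f -> \int[m]_y f y = \int[l]_x \int[k x]_y f y.
Proof.
move=> mix f bf; have [M M0 fM] := shift bf.
have pos g : bmf g -> (forall x, 0 <= g x) ->
    \int[m]_y g y = \int[l]_x \int[k x]_y g y.
  move=> bg g0; rewrite {1}/Rintegral mix; last 2 first.
  - by case: bg => mg _; exact/measurable_EFinP.
  - by move=> y; rewrite lee_fin.
  by congr fine; apply: eq_integral => x _; rewrite bmf_EFin.
have bM : bmf (fun _ : T => M) by exact: bmf_cst.
have bfM : bmf (fun y => f y + M) by exact: bmfD.
apply: (@addIr _ (\int[m]_y M)).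
rewrite -bintD// pos// (pos (fun _ => M))// -bintD; try exact: bmf_kint.
by apply: eq_Rintegral => x _; rewrite bintD.
Qed.

End kernel_integral.

Lemma bint_pushforward d1 (S : measurableType d1) d2 (T : measurableType d2) (R : realType)
    (P : {finite_measure set S -> \bar R}) (m : {measure set T -> \bar R}) (u : S -> T)
    (mu : measurable_fun setT u) :
  (forall U, measurable U -> m U = P (u @^-1` U)) ->
  forall f : T -> R, bmf f -> \int[m]_y f y = \int[P]_x f (u x).
Proof.
move=> mE f bf; have [mf _] := bf.
have mEf : measurable_fun setT (fun y => (f y)%:E) by exact/measurable_EFinP.
congr fine.
have -> : (\int[m]_y (f y)%:E = \int[pushforward P u]_y (f y)%:E)%E.
  by apply: eq_measure_integral => A mA _; rewrite /pushforward mE.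
rewrite integral_pushforward//=.
by apply: (@bmf_integrable _ _ _ P (fun x => f (u x))); exact: bmf_comp bf.
Qed.

(** * Mixtures, images and products of subprobability measures *)

Section giry_bounded.
Context d1 (S : measurableType d1) d2 (T : measurableType d2) (R : realType).

Lemma giry_mass_le1 (m : giry T R) : fine (m setT) <= 1.
Proof.
rewrite -lee_fin fineK ?sprobability_setT//; exact: fin_num_measure.
Qed.

Lemma giry_evP (k : S -> giry T R) : measurable_fun setT k ->
  forall U, measurable U -> measurable_fun setT (fun x => k x U).
Proof. by move=> mk U mU; exact: measurableT_comp (measurable_giry_ev mU) mk. Qed.

Lemma bmf_gint (k : S -> giry T R) (mk : measurable_fun setT k) (f : T -> R) :
  bmf f -> bmf (fun x => \int[k x]_y f y).
Proof.
apply: (bmf_kint (k := k)); first exact: giry_evP.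
by exists 1 => x; exact: giry_mass_le1.
Qed.

Lemma bint_bind (k : S -> giry T R) (mk : measurable_fun setT k) (m : giry S R) (f : T -> R) :
  bmf f -> \int[giry_bind m mk]_y f y = \int[m]_x \int[k x]_y f y.
Proof.
apply: (bint_mixture (k := k)); first exact: giry_evP.
  by exists 1 => x; exact: giry_mass_le1.
exact: giry_int_bind.
Qed.

Lemma bint_map (u : S -> T) (mu : measurable_fun setT u) (m : giry S R) (f : T -> R) :
  bmf f -> \int[giry_map mu m]_y f y = \int[m]_x f (u x).
Proof. exact: bint_pushforward. Qed.

Lemma bint_ret (x : T) (f : T -> R) : bmf f -> \int[giry_ret x : giry T R]_y f y = f x.
Proof.
move=> [mf _]; rewrite /Rintegral [X in fine X]giry_int_ret//; exact/measurable_EFinP.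
Qed.

End giry_bounded.

Section giry_prod_bounded.
Context d1 (S : measurableType d1) d2 (T : measurableType d2) (R : realType).

Let mpair (x : S) : measurable_fun setT (fun y : T => (x, y)).
Proof. exact: pair1_measurable. Qed.

Let measurable_giry_map_pair (m2 : giry T R) U : measurable U ->
  measurable_fun setT (fun x => giry_map (mpair x) m2 U).
Proof.
move=> mU; rewrite /giry_map /= /pushforward.
rewrite (_ : (fun _ => _) = (m2 \o xsection U)); first exact: measurable_fun_xsection.
by apply/funext => x /=; rewrite xsectionE.
Qed.

(** The measures in play are the images of [m] under [y |-> (x, y)], a kernel in [x]; the product
    measure is their mixture, which also gives Fubini below. *)
Lemma bmf_section_int (m : giry T R) (f : S * T -> R) : bmf f ->
  bmf (fun x => \int[m]_y f (x, y)).
Proof.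
move=> bf; have := bmf_kint (measurable_giry_map_pair m) _ bf.
rewrite (_ : (fun x => _) = (fun x => \int[m]_y f (x, y))).
  by apply; exists 1 => x; exact: giry_mass_le1.
by apply/funext => x; exact: (bint_map (mpair x) m bf).
Qed.

Lemma bint_prod (m1 : giry S R) (m2 : giry T R) (f : S * T -> R) : bmf f ->
  \int[giry_prod (m1, m2)]_p f p = \int[m1]_x \int[m2]_y f (x, y).
Proof.
move=> bf.
rewrite (bint_mixture (@measurable_giry_map_pair m2) _ (l := m1))//.
- by apply: eq_Rintegral => x _; exact: (bint_map (mpair x) m2 bf).
- by exists 1 => x; exact: giry_mass_le1.
- move=> g mg g0; rewrite [LHS](giry_int_prod1 m1 m2)//.
  by apply: eq_integral => x _; rewrite [RHS]giry_int_map.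
Qed.

End giry_prod_bounded.

(** Uniqueness of measures on a generating pi-system. Since [G] contains the whole space, the
    constant sequence [setT] is an exhaustion by sets of finite mass. *)
Lemma giry_unique d (T : measurableType d) (R : realType) (G : set (set T))
    (m1 m2 : giry T R) :
  measurable = <<s G >> -> setI_closed G -> G setT ->
  (forall A, G A -> m1 A = m2 A) ->
  forall f : T -> R, \int[m1]_x f x = \int[m2]_x f x.
Proof.
move=> mG GI GT m12 f; congr fine; apply: eq_measure_integral => A mA _.
apply: (measure_unique G (fun=> setT)) => //.
  by rewrite bigcup_const.
by move=> _; rewrite -ge0_fin_numE//; exact: fin_num_measure.
Qed.

(** * Trajectories of the chain *)

Section trajectories.
Context (X Z : ptopologicalType).

(* [traj X Z n] below carries the sigma-algebra of the first [n] coordinates; all the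
   [n] share the carrier of infinite sequences of (state, noise) pairs. *)
Definition rects (n : nat) : set (set (nat -> X * Z)) :=
  [set E | exists (A : nat -> set (borel X)) (C : nat -> set (borel Z)),
     [/\ (forall i, measurable (A i)), (forall i, measurable (C i)) &
         E = [set s | forall i, (i < n)%N -> A i (s i).1 /\ C i (s i).2]]].

End trajectories.
Arguments rects X Z n : clear implicits.
Notation traj X Z n := (g_sigma_algebraType (rects X Z n)).

Section measurability.
Context (X Y Z : ptopologicalType).

Lemma measurable_traj d (W : measurableType d) n (u : W -> traj X Z n) :
  (forall i, (i < n)%N -> measurable_fun setT (fun w => (u w i).1 : borel X)) ->
  (forall i, (i < n)%N -> measurable_fun setT (fun w => (u w i).2 : borel Z)) ->
  measurable_fun setT u.
Proof.
move=> m1 m2; apply: (@measurability _ _ W (traj X Z n) setT u (rects X Z n)) => //.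
move=> _ [_ [A [C [mA mC ->]]] <-]; rewrite setTI.
rewrite (_ : _ @^-1` _ = \bigcap_(i in `I_n)
   ((fun w => (u w i).1 : borel X) @^-1` A i `&` (fun w => (u w i).2 : borel Z) @^-1` C i)).
  apply: fin_bigcap_measurable => // i /= ni.
  by apply: measurableI; rewrite -[X in measurable X]setTI; [exact: m1|exact: m2].
by apply/seteqP; split.
Qed.

Lemma measurable_obs d (W : measurableType d) n (u : W -> obs (borel Y) n) :
  (forall i, (i < n)%N -> measurable_fun setT (fun w => u w i : borel Y)) ->
  measurable_fun setT u.
Proof.
move=> m1; apply: (@measurability _ _ W (obs (borel Y) n) setT u (cyl (borel Y) n)) => //.
move=> _ [_ [B [mB ->]] <-]; rewrite setTI.
rewrite (_ : _ @^-1` _ = \bigcap_(i in `I_n) ((fun w => u w i : borel Y) @^-1` B i)).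
  apply: fin_bigcap_measurable => // i /= ni.
  by rewrite -[X in measurable X]setTI; exact: m1.
by apply/seteqP; split.
Qed.

Lemma measurable_state n i : (i < n)%N ->
  measurable_fun setT (fun s : traj X Z n => (s i).1 : borel X).
Proof.
move=> ni _ A mA; rewrite setTI; apply: sub_sigma_algebra.
exists (fun j => if j == i then A else setT), (fun=> setT); split => //.
  by move=> j; case: ifP.
apply/seteqP; split => s /=; first by move=> As j _; case: eqP => [->|].
by move=> /(_ _ ni); rewrite eqxx => -[].
Qed.

Lemma measurable_noise n i : (i < n)%N ->
  measurable_fun setT (fun s : traj X Z n => (s i).2 : borel Z).
Proof.
move=> ni _ A mA; rewrite setTI; apply: sub_sigma_algebra.
exists (fun=> setT), (fun j => if j == i then A else setT); split => //.
  by move=> j; case: ifP.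
apply/seteqP; split => s /=; first by move=> As j _; case: eqP => [->|].
by move=> /(_ _ ni); rewrite eqxx => -[].
Qed.

Lemma measurable_obs_coord n i : (i < n)%N ->
  measurable_fun setT (fun y : obs (borel Y) n => y i : borel Y).
Proof.
move=> ni _ A mA; rewrite setTI; apply: sub_sigma_algebra.
exists (fun j => if j == i then A else setT); split; first by move=> j; case: ifP.
apply/seteqP; split => s /=; first by move=> As j _; case: eqP => [->|].
by move=> /(_ _ ni); rewrite eqxx.
Qed.

End measurability.

Section giry_of_pker.
Context d1 (S : measurableType d1) d2 (T : measurableType d2) (R : realType).
Variable k : R.-pker S ~> T.

Section pointwise.
Variable x : S.
(** The measure [k x] rewrapped as a subprobability, so that the kernel becomes a measurable map
    into [giry T R] and can be fed to [giry_bind]. *)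
Definition pker_ev : set T -> \bar R := k x.

HB.instance Definition _ := isMeasure.Build _ _ _ pker_ev
  (measure0 (k x)) (measure_ge0 (k x)) (@measure_semi_sigma_additive _ _ _ (k x)).

Let pker_ev_le1 : (pker_ev setT <= 1)%E.
Proof. by rewrite /pker_ev prob_kernel. Qed.

HB.instance Definition _ := Measure_isSubProbability.Build _ _ _ pker_ev pker_ev_le1.

Definition giry_of_pker : giry T R := pker_ev.

End pointwise.

Lemma measurable_giry_of_pker : measurable_fun setT giry_of_pker.
Proof. by apply: measurable_giry_codensity => // B mB; exact: measurable_kernel. Qed.

Lemma bint_giry_of_pker x (f : T -> R) : \int[giry_of_pker x]_y f y = \int[k x]_y f y.
Proof. by congr fine; apply: eq_measure_integral. Qed.

Lemma giry_of_pker_cst x (c : R) : \int[giry_of_pker x]_y c = c.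
Proof.
rewrite bint_giry_of_pker Rintegral_cst// -[RHS]mulr1; congr (c * _).
by have /(congr1 fine) := @prob_kernel _ _ _ _ _ k x.
Qed.

End giry_of_pker.

(** Joint measurability in a parameter and a starting point: the Dirac mass at [p.1] times [k p.2]
    is a measurable kernel, and integrating [F] against it gives this function. *)
Lemma bmf_gint2 d0 (W : measurableType d0) d1 (S : measurableType d1)
    d2 (T : measurableType d2) (R : realType) (k : S -> giry T R)
    (mk : measurable_fun setT k) (F : W * T -> R) :
  bmf F -> bmf (fun p : W * S => \int[k p.2]_y F (p.1, y)).
Proof.
move=> bF.
have mg : measurable_fun setT (fun p : W * S => (giry_ret p.1 : giry W R, k p.2)).
  apply: measurable_fun_pair.
    exact: measurableT_comp (@measurable_giry_ret _ _ _) measurable_fst.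
  exact: measurableT_comp mk measurable_snd.
have mp : measurable_fun setT (fun p : W * S => giry_prod (giry_ret p.1 : giry W R, k p.2)).
  exact: measurableT_comp (@measurable_giry_prod _ _ _ _ _) mg.
have := bmf_gint mp bF.
rewrite (_ : (fun x => _) = (fun p : W * S => \int[k p.2]_y F (p.1, y)))//.
by apply/funext => p; rewrite bint_prod// bint_ret//; exact: bmf_section_int.
Qed.

Section chain_kernel.
Context (R : realType) (X Z : ptopologicalType).
Variables (T : R.-pker (borel X) ~> (borel X)) (Q : probability (borel Z) R).

Definition tcons n (p : borel X * (borel Z * traj X Z n)) : traj X Z n.+1 :=
  fun i => if i is j.+1 then p.2.2 j else (p.1, p.2.1).

Lemma measurable_tcons n : measurable_fun setT (@tcons n).
Proof.
apply: measurable_traj => -[|i] /= ni.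
- exact: measurable_fst.
- apply: (measurableT_comp (measurable_state (ni : (i < n)%N))
    (_ : measurable_fun setT (fun p => p.2.2))).
  exact: measurableT_comp measurable_snd measurable_snd.
- exact: measurableT_comp measurable_fst measurable_snd.
- apply: (measurableT_comp (measurable_noise (ni : (i < n)%N))
    (_ : measurable_fun setT (fun p => p.2.2))).
  exact: measurableT_comp measurable_snd measurable_snd.
Qed.

Definition traj_step n (k : borel X -> giry (traj X Z n) R) (mk : measurable_fun setT k) :
    borel X -> giry (traj X Z n.+1) R :=
  fun x => giry_map (@measurable_tcons n)
    (giry_prod (giry_ret x : giry _ R,
       giry_prod (Q : giry _ R, giry_bind (giry_of_pker T x) mk))).

Lemma measurable_traj_step n (k : borel X -> giry (traj X Z n) R)
  (mk : measurable_fun setT k) : measurable_fun setT (traj_step mk).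
Proof.
apply: (measurableT_comp (measurable_giry_map _ )) => //.
apply: (measurableT_comp (@measurable_giry_prod _ _ _ _ _)) => //.
apply: measurable_fun_pair; first exact: measurable_giry_ret.
apply: (measurableT_comp (@measurable_giry_prod _ _ _ _ _)) => //.
apply: measurable_fun_pair; first exact: measurable_cst.
apply: (measurableT_comp (measurable_giry_bind mk)) => //.
exact: measurable_giry_of_pker.
Qed.

(** Law of the first [n] pairs (state, noise) of the chain started at [x]. It is built together with
    its measurability, which [giry_bind] requires at the next stage. The choice of [point] for
    [n = 0] is harmless: [traj X Z 0] sees no coordinate. *)
Fixpoint traj_law_sig n : {k : borel X -> giry (traj X Z n) R | measurable_fun setT k} :=
  if n is m.+1 then
    exist _ (traj_step (projT2 (traj_law_sig m))) (measurable_traj_step (projT2 (traj_law_sig m)))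
  else exist _ (fun=> giry_ret (point : traj X Z 0)) (@measurable_cst _ _ _ _ _ _).

Definition traj_law n : borel X -> giry (traj X Z n) R := projT1 (traj_law_sig n).

Local Notation K := traj_law.

Lemma measurable_K n : measurable_fun setT (K n).
Proof. exact: projT2 (traj_law_sig n). Qed.

Lemma bint_K0 x (G : traj X Z 0 -> R) : bmf G -> \int[K 0 x]_s G s = G point.
Proof. exact: bint_ret. Qed.

Lemma bint_KS n x (G : traj X Z n.+1 -> R) : bmf G ->
  \int[K n.+1 x]_s G s =
  \int[Q]_z \int[giry_of_pker T x]_x' \int[K n x']_s G (tcons (x, (z, s))).
Proof.
move=> bG; have bG' := bmf_comp (@measurable_tcons n) bG.
rewrite [LHS]bint_map// bint_prod// bint_ret; last exact: bmf_section_int bG'.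
have bG'' := bmf_comp (@pair1_measurable _ _ _ _ x) bG'.
rewrite bint_prod//; apply: eq_Rintegral => z _.
by rewrite bint_bind//; exact: bmf_comp (@pair1_measurable _ _ _ _ z) bG''.
Qed.

Lemma bint_K_cst n x (c : R) : \int[K n x]_s c = c.
Proof.
elim: n x => [|n IH] x; first by rewrite bint_K0//; exact: bmf_cst.
rewrite bint_KS; last exact: bmf_cst.
rewrite -[RHS](bint_cst Q); apply: eq_Rintegral => z _.
rewrite -[RHS](giry_of_pker_cst T x); apply: eq_Rintegral => x' _.
exact: IH.
Qed.

End chain_kernel.

Arguments measurable_K {R X Z} T Q n.

(** * Restarting a trajectory at a given time *)

Section splice.
Context (A : Type).

Definition splice (n : nat) (s r : nat -> A) : nat -> A :=
  fun i => if (i < n)%N then s i else r (i - n)%N.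

Lemma splice_lt n s r i : (i < n)%N -> splice n s r i = s i.
Proof. by rewrite /splice => ->. Qed.

Lemma splice_add n s r i : splice n s r (n + i)%N = r i.
Proof. by rewrite /splice ltnNge leq_addr/= addKn. Qed.

Lemma splice_at n s r : splice n s r n = r 0%N.
Proof. by rewrite /splice ltnn subnn. Qed.

End splice.

Section splitting.
Context (R : realType) (X Z : ptopologicalType).
Variables (T : R.-pker (borel X) ~> (borel X)) (Q : probability (borel Z) R).
Local Notation K := (traj_law T Q).

Lemma measurable_splice n n' N : (n <= n')%N ->
  measurable_fun setT (fun p : traj X Z n' * traj X Z N =>
    splice n p.1 p.2 : traj X Z (n + N)).
Proof.
move=> nn'; apply: measurable_traj => i iN; rewrite /splice; case: ltnP => ni.
- exact: (measurableT_comp (measurable_state (leq_trans ni nn')) measurable_fst).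
- have iN' : (i - n < N)%N by rewrite ltn_subLR.
  exact: (measurableT_comp (measurable_state iN') measurable_snd).
- exact: (measurableT_comp (measurable_noise (leq_trans ni nn')) measurable_fst).
- have iN' : (i - n < N)%N by rewrite ltn_subLR.
  exact: (measurableT_comp (measurable_noise iN') measurable_snd).
Qed.

Lemma bmf_continuation n N (G : traj X Z (n + N) -> R) : bmf G ->
  bmf (fun s : traj X Z n.+1 => \int[K N (s n).1]_r G (splice n s r)).
Proof.
move=> bG.
have bGs := bmf_comp (@measurable_splice n n.+1 N (leqnSn n)) bG.
have mp : measurable_fun setT (fun s : traj X Z n.+1 => (s, (s n).1 : borel X)).
  by apply: measurable_fun_pair => //; exact: measurable_state.
by have := bmf_comp mp (bmf_gint2 (measurable_K T Q N) bGs).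
Qed.

(** Markov property of the trajectory law. The outer trajectory has [n.+1] coordinates only to
    reveal the state at time [n]; its noise at that time is discarded by [splice n] and drawn afresh
    with [r]. *)
Lemma bint_K_split n N x (G : traj X Z (n + N) -> R) : bmf G ->
  \int[K (n + N) x]_s G s = \int[K n.+1 x]_s \int[K N (s n).1]_r G (splice n s r).
Proof.
elim: n x G => [|n IH] x G bG; rewrite (bint_KS _ _ _ (bmf_continuation bG)).
  transitivity (\int[Q]_z \int[giry_of_pker T x]_x' \int[K 0 x']_s \int[K N x]_r G r).
    rewrite -[LHS](bint_cst Q); apply: eq_Rintegral => z _.
    rewrite -[LHS](giry_of_pker_cst T x); apply: eq_Rintegral => x' _.
    by rewrite bint_K_cst.
  apply: eq_Rintegral => z _; apply: eq_Rintegral => x' _; apply: eq_Rintegral => s _.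
  apply: eq_Rintegral => r _; congr G; apply/funext => i.
  by rewrite /splice ltn0 subn0.
apply: (etrans (@bint_KS _ _ _ T Q (n + N) x G bG)).
apply: eq_Rintegral => z _; apply: eq_Rintegral => x' _.
have bG' : bmf (fun s => G (tcons (x, (z, s)))).
  have := bmf_comp (@measurable_tcons _ _ _) bG.
  move=> /(bmf_comp (@pair1_measurable _ _ _ _ x)).
  by move=> /(bmf_comp (@pair1_measurable _ _ _ _ z)).
rewrite IH//; apply: eq_Rintegral => s _; apply: eq_Rintegral => r _.
by congr G; apply/funext => -[|i]; rewrite /splice/= ?ltnS ?subSS.
Qed.

End splitting.

Lemma obs_measurable_ext (R : realType) (Y : ptopologicalType) n (g : obs (borel Y) n -> R) :
  measurable_fun setT g -> forall y y', (forall i, (i < n)%N -> y i = y' i) -> g y = g y'.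
Proof.
move=> mg y y' yy'.
have : <<s cyl (borel Y) n >> (g @^-1` [set g y]).
  by rewrite -[X in _ X]setTI; apply: mg => //; exact: measurable_set1.
move=> /(_ [set B | B y <-> B y']) /= H.
apply/esym; apply H => //; split; last first.
  move=> _ [B [_ ->]] /=; split => By i ni; first by rewrite -yy'//; exact: By.
  by rewrite yy'//; exact: By.
split => //=; first by move=> B; rewrite /setD /=; tauto.
move=> F FB; split => -[i _ Fi]; exists i => //; exact/FB.
Qed.

(** * Observations carried by a trajectory *)

Section observations.
Context (R : realType) (X Y Z : ptopologicalType).
Variables (T : R.-pker (borel X) ~> (borel X)) (Q : probability (borel Z) R).
Variable h : X -> Z -> Y.
Hypothesis mh : measurable_fun setT (fun p : borel X * borel Z => (h p.1 p.2 : borel Y)).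
Local Notation K := (traj_law T Q).

Definition ymap (s : nat -> X * Z) : nat -> Y := fun i => h (s i).1 (s i).2.

Lemma measurable_ymap n m : (n <= m)%N ->
  measurable_fun setT (ymap : traj X Z m -> obs (borel Y) n).
Proof.
move=> nm; apply: measurable_obs => i ni; have mi := leq_trans ni nm.
apply: (measurableT_comp mh (_ : measurable_fun setT
  (fun s : traj X Z m => ((s i).1 : borel X, (s i).2 : borel Z)))).
by apply: measurable_fun_pair; [exact: measurable_state|exact: measurable_noise].
Qed.

Lemma measurable_ycons n :
  measurable_fun setT (fun p : borel Y * obs (borel Y) n => ycons p.1 p.2 : obs (borel Y) n.+1).
Proof.
apply: measurable_obs => -[|i] /= ni; first exact: measurable_fst.
exact: (measurableT_comp (measurable_obs_coord (ni : (i < n)%N)) measurable_snd).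
Qed.

Lemma cond_obsE N (g : obs (borel Y) N -> R) x : bmf g ->
  cond_obs T Q h N (fun y => (g y)%:E) x = (\int[K N x]_s g (ymap s))%:E.
Proof.
elim: N g x => [|N IH] g x bg.
  rewrite bint_K0; last exact: bmf_comp (measurable_ymap (leqnn 0)) bg.
  (* The two filler sequences may differ, but [g] sees none of their coordinates. *)
  by congr EFin; apply: (obs_measurable_ext bg.1).
have bgy : bmf (fun s : traj X Z N.+1 => g (ymap s)).
  exact: bmf_comp (measurable_ymap (leqnn _)) bg.
have bgc : bmf (fun p : borel Z * traj X Z N => g (ymap (tcons ((x : borel X), p)))).
  by have := bmf_comp (@pair1_measurable _ _ _ _ (x : borel X))
    (bmf_comp (@measurable_tcons _ _ _) bgy).
have bK : bmf (fun p : borel Z * borel X =>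
    \int[K N p.2]_s g (ymap (tcons (x : borel X, (p.1, s))))).
  exact: (bmf_gint2 (measurable_K T Q N) bgc).
rewrite bint_KS//=.
have bin : bmf (fun z : borel Z => \int[giry_of_pker T x]_x'
    \int[K N x']_s g (ymap (tcons (x : borel X, (z, s))))).
  exact: (bmf_section_int (giry_of_pker T x) bK).
rewrite -bmf_EFin//; apply: eq_integral => z _.
transitivity (\int[giry_of_pker T x]_x'
    (\int[K N x']_s g (ymap (tcons (x : borel X, (z, s)))))%:E)%E.
  rewrite [RHS](eq_measure_integral (T x))//; apply: eq_integral => x' _.
  rewrite (IH (fun y => g (ycons (h x z) y))); last first.
    by have := bmf_comp (@pair1_measurable _ _ _ _ (h x z : borel Y))
      (bmf_comp (@measurable_ycons _) bg).
  congr EFin; apply: eq_Rintegral => s _; congr g.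
  by apply/funext => -[|i].
rewrite bmf_EFin//.
by have := bmf_comp (@pair1_measurable _ _ _ _ (z : borel Z)) bK.
Qed.

End observations.

(** * Laws of the process and of its filter through the trajectory law *)

Section law.
Context (R : realType) (X Z : ptopologicalType).
Variables (T : R.-pker (borel X) ~> (borel X)) (Q : probability (borel Z) R).
Local Notation K := (traj_law T Q).

Definition rect_fun (A : nat -> set (borel X)) (C : nat -> set (borel Z)) n
    (s : nat -> X * Z) : R :=
  \prod_(i < n) (\1_(A i) (s i).1 * \1_(C i) (s i).2).

Lemma rect_funS A C n x z (s : traj X Z n) : rect_fun A C n.+1 (tcons (x, (z, s))) =
  \1_(A 0%N) x * \1_(C 0%N) z * rect_fun (fun i => A i.+1) (fun i => C i.+1) n s.
Proof. by rewrite /rect_fun big_ord_recl. Qed.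

Lemma rect_fun_indic A C n : rect_fun A C n =
  \1_[set s | forall i, (i < n)%N -> A i (s i).1 /\ C i (s i).2].
Proof.
apply/funext => s; rewrite /rect_fun [RHS]indicE.
case: (boolP (s \in _)) => [/set_mem|/negP/(contra_not (@mem_set _ _ _))] /= H.
  apply: big1 => i _; have [A1 C1] := H i (ltn_ord i).
  by rewrite !indicE !mem_set// mulr1.
suff [i Hi] : exists i : 'I_n, ~ (A i (s i).1 /\ C i (s i).2).
  rewrite (bigD1 i)//= !indicE.
  case: (pselect (A i (s i).1)) => A1; last by rewrite (memNset A1) !mul0r.
  rewrite [X in _ * X * _](_ : _ = 0) ?mulr0 ?mul0r// memNset// => C1.
  exact: Hi.
apply: contrapT => /forallNP Hn; apply: H => i ni.
exact: contrapT (Hn (Ordinal ni)).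
Qed.

Lemma measurable_rect (A : nat -> set (borel X)) (C : nat -> set (borel Z)) n :
  (forall i, measurable (A i)) -> (forall i, measurable (C i)) ->
  measurable ([set s : nat -> X * Z | forall i, (i < n)%N -> A i (s i).1 /\ C i (s i).2]
    : set (traj X Z n)).
Proof. by move=> mA mC; apply: sub_sigma_algebra; exists A, C; split. Qed.

Lemma bmf_rect_fun (A : nat -> set (borel X)) (C : nat -> set (borel Z)) n :
  (forall i, measurable (A i)) -> (forall i, measurable (C i)) ->
  bmf (rect_fun A C n : traj X Z n -> R).
Proof. by move=> mA mC; rewrite rect_fun_indic; apply: bmf_indic; exact: measurable_rect. Qed.

Lemma chain_int_ge0 n A x : (0 <= chain_int T n A x)%E.
Proof.
elim: n A x => [|n IH] A x /=; first by rewrite lee_fin indicE.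
by rewrite mule_ge0// ?lee_fin ?indicE//; apply: integral_ge0.
Qed.

Lemma measurable_chain_int n A : (forall i, measurable (A i)) ->
  measurable_fun setT (chain_int T n A).
Proof.
elim: n A => [|n IH] A mA /=; first exact/measurable_EFinP/measurable_indic.
apply: emeasurable_funM; first exact/measurable_EFinP/measurable_indic.
apply: measurable_fun_integral_kernel; first exact: measurable_kernel.
  by move=> x; exact: chain_int_ge0.
exact: IH.
Qed.

(** These are the rectangle probabilities that define [hmm_process]: each noise is independent of
    the rest, so its factor leaves the integral and only the recursion of [chain_int] remains. *)
Lemma bint_K_rect n (A : nat -> set (borel X)) (C : nat -> set (borel Z)) x :
  (forall i, measurable (A i)) -> (forall i, measurable (C i)) ->
  (\int[K n.+1 x]_s rect_fun A C n.+1 s)%:E =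
  (\prod_(i < n.+1) Q (C i) * chain_int T n A x)%E.
Proof.
elim: n A C x => [|n IH] A C x mA mC.
  rewrite bint_KS; last exact: bmf_rect_fun.
  have bC : bmf (\1_(C 0%N) : borel Z -> R) by exact: bmf_indic.
  transitivity (\int[Q]_z (\1_(A 0%N) x * \1_(C 0%N) z))%:E.
    congr EFin; apply: eq_Rintegral => z _.
    rewrite -[RHS](giry_of_pker_cst T x); apply: eq_Rintegral => x' _.
    rewrite -[RHS](bint_K_cst T Q 0 x'); apply: eq_Rintegral => s _.
    by rewrite rect_funS /rect_fun big_ord0 mulr1.
  rewrite bintZ// EFinM -bmf_EFin// integral_indic// setIT big_ord1 /=.
  by rewrite muleC.
rewrite bint_KS; last exact: bmf_rect_fun.
set A' := fun i => A i.+1; set C' := fun i => C i.+1.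
have mA' i : measurable (A' i) by exact: mA.
have mC' i : measurable (C' i) by exact: mC.
have bF : bmf (fun x' : borel X => \int[K n.+1 x']_s rect_fun A' C' n.+1 s).
  by apply: bmf_gint; [exact: measurable_K|exact: bmf_rect_fun].
have bC : bmf (\1_(C 0%N) : borel Z -> R) by exact: bmf_indic.
transitivity (\int[Q]_z (\1_(A 0%N) x *
    (\int[giry_of_pker T x]_x' \int[K n.+1 x']_s rect_fun A' C' n.+1 s) * \1_(C 0%N) z))%:E.
  congr EFin; apply: eq_Rintegral => z _.
  rewrite mulrAC -bintZ//; apply: eq_Rintegral => x' _.
  rewrite -bintZ; last exact: bmf_rect_fun.
  by apply: eq_Rintegral => s _; rewrite rect_funS.
rewrite bintZ// EFinM -(bmf_EFin Q bC) integral_indic// setIT EFinM.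
rewrite big_ord_recl/= -bmf_EFin//.
rewrite [X in (_ * X * _)%E](_ : _ = \prod_(i < n.+1) Q (C' i) *
    \int[T x]_y chain_int T n A' y)%E.
  by rewrite muleC -!muleA; congr (_ * _)%E; rewrite muleCA.
have mch := measurable_chain_int n mA'.
rewrite -ge0_integralZl//; last 2 first.
- by move=> y _; exact: chain_int_ge0.
- by apply: prode_ge0.
rewrite [LHS](eq_measure_integral (T x))//.
by apply: eq_integral => y _; rewrite IH.
Qed.

End law.

Section joint_kernel.
Context d1 (S : measurableType d1) d2 (T : measurableType d2) (R : realType).

Lemma measurable_joint (k : S -> giry T R) : measurable_fun setT k ->
  measurable_fun setT (fun x => giry_prod (giry_ret x : giry S R, k x)).
Proof.
move=> mk.
have mg : measurable_fun setT (fun x : S => (giry_ret x : giry S R, k x)).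
  by apply: measurable_fun_pair => //; exact: measurable_giry_ret.
exact: measurableT_comp (@measurable_giry_prod _ _ _ _ _) mg.
Qed.

Lemma bint_joint (k : S -> giry T R) x (f : S * T -> R) : bmf f ->
  \int[giry_prod (giry_ret x : giry S R, k x)]_p f p = \int[k x]_y f (x, y).
Proof. by move=> bf; rewrite bint_prod// bint_ret//; exact: bmf_section_int. Qed.

End joint_kernel.

Lemma bint_indic d (T : measurableType d) (R : realType) (m : {finite_measure set T -> \bar R})
  (A : set T) : measurable A -> (\int[m]_x \1_A x)%:E = m A.
Proof.
move=> mA; rewrite -bmf_EFin; last exact: bmf_indic.
by rewrite integral_indic// setIT.
Qed.

Section hmm_law.
Context (R : realType) (X Y Z : ptopologicalType).
Variables (T : R.-pker (borel X) ~> (borel X)) (Q : probability (borel Z) R).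
Variable h : X -> Z -> Y.
Hypothesis mh : measurable_fun setT (fun p : borel X * borel Z => (h p.1 p.2 : borel Y)).
Context d (Om : measurableType d) (P : probability Om R) (mu : probability (borel X) R).
Variables (Xs : nat -> Om -> X) (Zs : nat -> Om -> Z).
Hypothesis proc : hmm_process T Q P mu Xs Zs.
Local Notation K := (traj_law T Q).

Definition traj_of (w : Om) : nat -> X * Z := fun i => (Xs i w, Zs i w).

Lemma measurable_traj_of n : measurable_fun setT (traj_of : Om -> traj X Z n).
Proof. by case: proc => mX mZ _; apply: measurable_traj => i _; [exact: mX|exact: mZ]. Qed.

Lemma measurable_obsseq n : measurable_fun setT (obsseq h Xs Zs : Om -> obs (borel Y) n).
Proof.
case: proc => mX mZ _; apply: measurable_obs => i _.
apply: (measurableT_comp mh (_ : measurable_fun setT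
  (fun w => (Xs i w : borel X, Zs i w : borel Z)))).
by apply: measurable_fun_pair; [exact: mX|exact: mZ].
Qed.

(** Rectangles are a generating pi-system on which both laws agree. From here on, computations on
    the abstract space [Om] can be done with the explicit kernel. *)
Lemma hmm_law n (G : traj X Z n.+1 -> R) : bmf G ->
  \int[P]_w G (traj_of w) = \int[mu]_x \int[K n.+1 x]_s G s.
Proof.
move=> bG.
have <- := bint_bind (measurable_K T Q n.+1) (mu : giry _ R) bG.
have <- := bint_map (@measurable_traj_of n.+1) (P : giry _ R) bG.
apply: (@giry_unique _ (traj X Z n.+1) R (rects X Z n.+1)) => //.
- move=> _ _ [A [C [mA mC ->]]] [A' [C' [mA' mC' ->]]].
  exists (fun i => A i `&` A' i), (fun i => C i `&` C' i); split.
  + by move=> i; exact: measurableI.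
  + by move=> i; exact: measurableI.
  apply/seteqP; split => s /=.
    by move=> [H1 H2] i ni; have [? ?] := H1 i ni; have [? ?] := H2 i ni.
  by move=> H; split => i ni; have [[? ?] [? ?]] := H i ni.
- by exists (fun=> setT), (fun=> setT); split => //; apply/seteqP; split.
move=> _ [A [C [mA mC ->]]].
have mE := @measurable_rect _ _ A C n.+1 mA mC.
have bE : bmf (rect_fun R A C n.+1 : traj X Z n.+1 -> R) by exact: bmf_rect_fun.
rewrite -[RHS](bint_indic _ mE) -rect_fun_indic bint_bind// -bmf_EFin; last first.
  by have := bmf_gint (@measurable_K _ _ _ T Q n.+1) bE.
under eq_integral do rewrite bint_K_rect//.
rewrite ge0_integralZl//.
- by case: proc => _ _ /(_ n A C mA mC) <-.
- exact: measurable_chain_int.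
- by move=> x _; exact: chain_int_ge0.
- by apply: prode_ge0.
Qed.

Variable F : nat -> (nat -> Y) -> probability (borel X) R.
Hypothesis filt : is_filter h P Xs Zs F.

Lemma measurable_filter n :
  measurable_fun setT (fun y : obs (borel Y) n.+1 => F n y : giry (borel X) R).
Proof. by apply: measurable_giry_codensity => // A mA; exact: (filt n).1. Qed.

(** The definition of the filter is the case where [G] is the indicator of a product set; these sets
    form a generating pi-system, so the joint law of observations and state disintegrates along
    [F n]. *)
Lemma bint_filter n (G : obs (borel Y) n.+1 * borel X -> R) : bmf G ->
  \int[P]_w G (obsseq h Xs Zs w, Xs n w) =
  \int[P]_w \int[F n (obsseq h Xs Zs w)]_x G (obsseq h Xs Zs w, x).
Proof.
move=> bG.
have mX : measurable_fun setT (Xs n : Om -> borel X) by case: proc.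
have mY := @measurable_obsseq n.+1.
have mYX : measurable_fun setT (fun w => (obsseq h Xs Zs w : obs (borel Y) n.+1, Xs n w : borel X)).
  exact: measurable_fun_pair.
have mF := @measurable_filter n.
have mJ := measurable_joint mF.
have bJE y := @bint_joint _ (obs (borel Y) n.+1) _ _ R (fun y => F n y : giry (borel X) R) y.
have <- := bint_map mYX (P : giry _ R) bG.
have bF : bmf (fun y : obs (borel Y) n.+1 => \int[F n y]_x G (y, x)).
  have := bmf_gint mJ bG.
  by rewrite (_ : (fun x => _) = (fun y : obs (borel Y) n.+1 => \int[F n y]_x G (y, x)))//;
    apply/funext => y; exact: (bJE y G bG).
have <- := bint_map mY (P : giry _ R) bF.
transitivity (\int[giry_bind (giry_map mY (P : giry _ R)) mJ]_p G p); last first.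
  by rewrite bint_bind//; apply: eq_Rintegral => y _; exact: (bJE y G bG).
apply: (@giry_unique _ (obs (borel Y) n.+1 * borel X)%type R
  [set B `*` A | B in measurable & A in measurable]).
- exact: measurable_prod_measurableType.
- move=> _ _ [A1 mA1 [A2 mA2 <-]] [B1 mB1 [B2 mB2 <-]].
  exists (A1 `&` B1); first exact: measurableI.
  by exists (A2 `&` B2); [exact: measurableI|rewrite setXI].
- by exists setT => //; exists setT => //; rewrite setXTT.
move=> _ [B mB [A mA <-]].
have mBA : measurable (B `*` A) by exact: measurableX.
have bBA := @bmf_indic _ _ R _ mBA.
rewrite -[RHS](bint_indic _ mBA) bint_bind//.
have bJ := bmf_gint mJ bBA.
rewrite bint_map//.
have -> : giry_map mYX (P : giry _ R) (B `*` A) =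
    P ((Xs n @^-1` A) `&` (obsseq h Xs Zs @^-1` B)).
  by rewrite /giry_map/= /pushforward; congr (P _); apply/seteqP; split => w [].
rewrite ((filt n).2 A B mA mB) -bmf_EFin; last exact: bmf_comp mY bJ.
rewrite integral_mkcond; apply: eq_integral => w _.
rewrite (bJE _ _ bBA) patchE.
case: ifPn => [/set_mem Bw|/negP/(contra_not (@mem_set _ _ _)) Bw].
  rewrite -(bint_indic (F n (obsseq h Xs Zs w)) mA); congr EFin.
  apply: eq_Rintegral => x _; rewrite !indicE (_ : (_ \in B `*` A) = (x \in A))//.
  apply/idP/idP => /set_mem H; last by apply/mem_set; split.
  by apply/mem_set; case: H.
rewrite (_ : \int[_]_y _ = 0)//.
rewrite -[RHS](mul0r (fine (F n (obsseq h Xs Zs w) setT))) -Rintegral_cst//.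
by apply: eq_Rintegral => x _; rewrite indicE memNset// => -[].
Qed.

End hmm_law.

(** * Sign patterns *)

Section gliding_hump.

Definition agree (n : nat) (c c' : nat -> bool) := forall k, (k < n)%N -> c k = c' k.

(* Baire category in the Cantor space: if no [K], [c0], [G] worked, gluing longer and
   longer bad patterns would give a sequence that is good for no [G]. *)
Lemma uniform_bound (good : nat -> (nat -> bool) -> Prop) :
  (forall c, exists G, good G c) ->
  exists K c0 G, forall s, agree K s c0 -> forall L, exists2 c, agree L c s & good G c.
Proof.
move=> ex_good; apply: contrapT => bad.
(* If the claim fails at the pattern [p] and the bound [G], some [s] extending [p] and some [L] are
   such that no sequence agreeing with [s] below [L] is good for [G]. The new pattern is [s], cut
   beyond both [p.1] and [L]. *)
have step (p : nat * (nat -> bool)) (G : nat) : exists q : nat * (nat -> bool),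
    [/\ (p.1 < q.1)%N, agree p.1 q.2 p.2 & forall c, agree q.1 c q.2 -> ~ good G c].
  apply: contrapT => nq; apply: bad; exists p.1, p.2, G => s sp L.
  apply: contrapT => nc; apply: nq; exists ((maxn p.1 L).+1, s); split => //=.
    by rewrite ltnS leq_maxl.
  move=> c cs gc; apply: nc; exists c => // k kL; apply: cs.
  by rewrite ltnS (leq_trans (ltnW kL))// leq_maxr.
have [next nextP'] := choice (fun pG => step pG.1 pG.2).
have nextP p G := nextP' (p, G).
pose st := fix st j := if j is i.+1 then next (st i, i) else (0%N, fun=> false).
have st1 j : ((st j).1 < (st j.+1).1)%N by have [] := nextP (st j) j.
have st_ge j : (j <= (st j).1)%N.
  by elim: j => // j IH; exact: leq_ltn_trans IH (st1 j).
have st_agree i j : (i <= j)%N -> agree (st i).1 (st j).2 (st i).2 /\ ((st i).1 <= (st j).1)%N.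
  elim: j => [|j IH]; first by rewrite leqn0 => /eqP ->.
  rewrite leq_eqVlt => /predU1P[->//|]; rewrite ltnS => /IH [aij lij].
  have [lt ag _] := nextP (st j) j; split; last exact: leq_trans lij (ltnW lt).
  by move=> k ki; rewrite -aij// [LHS]ag//; exact: leq_trans ki lij.
(* Stage [k.+1] has length at least [k.+1], so it settles coordinate [k], and later stages keep
   it. *)
pose c k := (st k.+1).2 k.
have cst j : agree (st j).1 c (st j).2.
  move=> k kj; rewrite /c; case: (leqP j k.+1) => jk; first by have [->] := st_agree _ _ jk.
  have [a _] := st_agree _ _ (ltnW jk); apply/esym/a.
  exact: leq_trans (st_ge k.+1).
have [G gG] := ex_good c.
by have [_ _ /(_ c)] := nextP (st G) G; apply => //; exact: (cst G.+1).
Qed.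

End gliding_hump.

Section signs.
Context (R : realType).

Definition bsign (b : bool) : R := if b then 1 else -1.

(** The law of independent signs with means [r i]: the sign b at place i has probability (1 + b r_i)
    / 2. It writes the coefficients [r] as an average of sign patterns. *)
Definition sign_weight L (r : nat -> R) (s : {ffun 'I_L -> bool}) : R :=
  \prod_(i < L) ((1 + bsign (s i) * r i) / 2).

Lemma norm_bsign b : `|bsign b| = 1.
Proof. by case: b; rewrite /bsign ?normrN normr1. Qed.

Lemma sign_weight_ge0 L r (s : {ffun 'I_L -> bool}) : (forall k, `|r k| <= 1) ->
  0 <= sign_weight r s.
Proof.
move=> r1; apply: prodr_ge0 => i _; have := r1 i; rewrite ler_norml /bsign => /andP[].
by case: (s i); lra.
Qed.

Lemma sum_sign_weight L r : \sum_(s : {ffun 'I_L -> bool}) sign_weight r s = 1.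
Proof.
rewrite -(bigA_distr_bigA (fun (i : 'I_L) b => (1 + bsign b * r i) / 2)).
by apply: big1 => i _; rewrite big_bool /bsign /=; lra.
Qed.

Lemma sign_weight_mean L r (k : 'I_L) :
  \sum_(s : {ffun 'I_L -> bool}) sign_weight r s * bsign (s k) = r k.
Proof.
pose F (i : 'I_L) b := (1 + bsign b * r i) / 2 * (if i == k then bsign b else 1).
transitivity (\sum_(s : {ffun 'I_L -> bool}) \prod_(i < L) F i (s i)).
  apply: eq_bigr => s _; rewrite /F big_split/=; congr (_ * _).
  by rewrite -big_mkcond/= big_pred1_eq.
rewrite -bigA_distr_bigA (bigD1 k)//= [X in _ * X](_ : _ = 1).
  by rewrite big_bool /F eqxx /bsign /=; lra.
by apply: big1 => i ik; rewrite big_bool /F (negbTE ik) /bsign /=; lra.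
Qed.

End signs.

(** * Approximate projection and density *)

Section near_projection.
Context d (Om : measurableType d) (R : realType) (P : probability Om R) (Y : ptopologicalType).
Variable y : Om -> nat -> Y.
Hypothesis my : forall n, measurable_fun setT (y : Om -> obs (borel Y) n).

Lemma bmf_obs_widen n m (psi : obs (borel Y) n -> R) : (n <= m)%N -> bmf psi ->
  bmf (psi : obs (borel Y) m -> R).
Proof.
move=> nm; apply: (bmf_comp (u := (id : obs (borel Y) m -> obs (borel Y) n))).
by apply: measurable_obs => i ni; apply: measurable_obs_coord; exact: leq_trans nm.
Qed.

(* A near minimizer of the L2 distance replaces the conditional expectation given
   the whole observation sequence. *)
Lemma near_projection (rho : Om -> R) (eta : R) : bmf rho -> 0 < eta ->
  exists (m : nat) (Lam : (nat -> Y) -> R), bmf (Lam : obs (borel Y) m -> R) /\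
    forall n (psi : (nat -> Y) -> R), (m <= n)%N ->
      measurable_fun setT (psi : obs (borel Y) n -> R) -> (forall v, `|psi v| <= 1) ->
      `|\int[P]_w ((rho w - Lam (y w)) * psi (y w))| <= eta.
Proof.
move=> brho eta0.
pose V := [set v : R | exists (m : nat) (Lam : (nat -> Y) -> R),
  bmf (Lam : obs (borel Y) m -> R) /\ v = \int[P]_w (rho w - Lam (y w)) ^+ 2].
have Vlb : lbound V 0.
  by move=> _ [m [Lam [_ ->]]]; apply: Rintegral_ge0 => w _; exact: sqr_ge0.
have hV : has_inf V.
  split; last by exists 0.
  by eexists; exists 0%N, (fun=> 0); split; [exact: bmf_cst|reflexivity].
have eta2 : 0 < eta ^+ 2 by exact: exprn_gt0.
have [_ [m [Lam [bLam ->]]] Lam_inf] := inf_adherent eta2 hV.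
exists m, Lam; split => // n psi mn mpsi psi1.
have bpsi : bmf (psi : obs (borel Y) n -> R) by exact: (@bmf_le _ _ _ _ 1).
have bLn := bmf_obs_widen mn bLam.
have bLy : bmf (fun w => Lam (y w)) by have := bmf_comp (@my n) bLn.
have bpy : bmf (fun w => psi (y w)) by have := bmf_comp (@my n) bpsi.
set a := \int[P]_w ((rho w - Lam (y w)) * psi (y w)).
(* [Lam + t * psi] competes in the infimum, which [Lam] attains up to [eta ^+ 2]; expanding the
   square gives the inequality. At t = eta and t = -eta it becomes the bound by [eta]. *)
have key t : 2 * (t * a) <= eta ^+ 2 + t ^+ 2.
  have : inf V <= \int[P]_w (rho w - (Lam (y w) + t * psi (y w))) ^+ 2.
    apply: ge_inf; first by exists 0.
    exists n, (fun v => Lam v + t * psi v); split => //.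
    by apply: bmfD => //; exact: bmfZ.
  rewrite (_ : (fun w => _) = (fun w => ((rho w - Lam (y w)) ^+ 2 -
    (2 * t) * ((rho w - Lam (y w)) * psi (y w))) + t ^+ 2 * (psi (y w) * psi (y w)))); last first.
    by apply/funext => w; rewrite !expr2; lra.
  have bd : bmf (fun w => rho w - Lam (y w)) by exact: bmfB.
  have bd2 : bmf (fun w => (rho w - Lam (y w)) ^+ 2).
    by rewrite (_ : (fun w => _) = (fun w => (rho w - Lam (y w)) * (rho w - Lam (y w))));
      [exact: bmfM|].
  rewrite bintD; [|apply: bmfB => //; apply: bmfZ; exact: bmfM|apply: bmfZ; exact: bmfM].
  rewrite bintB//; last by apply: bmfZ; exact: bmfM.
  rewrite !bintZ; try exact: bmfM.
  rewrite -/a => H.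
  have pp : \int[P]_w (psi (y w) * psi (y w)) <= 1.
    rewrite -[leRHS](bint_cst P); apply: ler_bint; [exact: bmfM|exact: bmf_cst|move=> w].
    by rewrite -expr2 -real_normK ?num_real// exprn_ile1.
  have tpp : t ^+ 2 * \int[P]_w (psi (y w) * psi (y w)) <= t ^+ 2.
    by rewrite ler_piMr// sqr_ge0.
  lra.
have := key eta; have := key (- eta).
rewrite sqrrN mulNr mulrN => H1 H2.
rewrite !expr2 in H1 H2.
by rewrite ler_norml; apply/andP; split; rewrite -(ler_pM2l eta0); lra.
Qed.

End near_projection.

Section bounded_density.
Context d (T : measurableType d) (R : realType) (mu nu : probability T R).

(** [rho] is the Radon-Nikodym derivative truncated at a level [K]. As it lies below the derivative
    and has mass at least 1 - eps, the difference between [mu] and [rho] times [nu] is a nonnegative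
    measure of mass at most eps. The bound follows by testing it on the nonnegative functions C + u
    and C - u. *)
Lemma bounded_density (eps : R) : mu `<< nu -> 0 < eps ->
  exists rho : T -> R, [/\ bmf rho, (forall x, 0 <= rho x), \int[nu]_x rho x <= 1 &
    forall (u : T -> R) C, measurable_fun setT u -> (forall x, `|u x| <= C) ->
      `|\int[mu]_x u x - \int[nu]_x (rho x * u x)| <= eps * C].
Proof.
move=> munu eps0.
pose f := Radon_Nikodym_SigmaFinite.f mu nu.
have f0 x : (0 <= f x)%E by exact: Radon_Nikodym_SigmaFinite.f_ge0.
have ffin x : f x \is a fin_num by exact: Radon_Nikodym_SigmaFinite.f_fin_num.
have mf : measurable_fun setT f.
  exact: measurable_int (Radon_Nikodym_SigmaFinite.f_integrable munu).
pose r x := fine (f x).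
have fE x : f x = (r x)%:E by rewrite /r fineK.
have r0 x : 0 <= r x by exact: fine_ge0.
have mr : measurable_fun setT r by exact: measurableT_comp.
pose rho (K : nat) x := Num.min (r x) K%:R.
have rho0 K x : 0 <= rho K x by rewrite le_min r0 ler0n.
have rhor K x : rho K x <= r x by rewrite ge_min lexx.
have mrho K : measurable_fun setT (rho K) by exact: measurable_minr.
have brho K : bmf (rho K).
  by apply: (@bmf_le _ _ _ _ K%:R) => // x; rewrite ger0_norm// ge_min lexx orbT.
have lower K (u : T -> R) : bmf u -> (forall x, 0 <= u x) ->
    \int[nu]_x (rho K x * u x) <= \int[mu]_x u x.
  move=> bu u0; have [mu_ _] := bu.
  rewrite -lee_fin -!bmf_EFin//; last exact: bmfM.
  rewrite -(Radon_Nikodym_SigmaFinite.change_of_variables munu)//; last exact/measurable_EFinP.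
  apply: ge0_le_integral => //.
  - by move=> x _; rewrite lee_fin mulr_ge0.
  - by apply/measurable_EFinP; exact: measurable_funM.
  - by apply: emeasurable_funM => //; exact/measurable_EFinP.
  - by move=> x _; rewrite -/f fE -EFinM lee_fin mulrC ler_wpM2l.
have [K HK] : exists K, 1 - eps <= \int[nu]_x rho K x.
  have cv : (\int[nu]_x (rho n x)%:E)%E @[n --> \oo] --> (\int[nu]_x f x)%E.
    rewrite (_ : (\int[nu]_x f x)%E = (\int[nu]_x limn (fun n => (rho n x)%:E))%E); last first.
      apply: eq_integral => x _; apply/esym/cvg_lim => //.
      rewrite fE; apply: cvg_EFin; first by near=> n.
      apply: cvg_near_cst; near=> n; rewrite /rho /=; apply/min_idPl.
      near: n; exact: nbhs_infty_ger.
    apply: cvg_monotone_convergence => //.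
    - by move=> n; exact/measurable_EFinP.
    - by move=> n x _; rewrite lee_fin.
    - move=> x _ a b ab; rewrite lee_fin le_min ge_min lexx/= ge_min ler_nat ab orbT//.
  have mass : (\int[nu]_x f x = 1)%E.
    rewrite -(Radon_Nikodym_SigmaFinite.f_integral munu measurableT).
    exact: probability_setT.
  rewrite mass in cv.
  have lt1 : ((1 - eps)%:E < 1%:E :> \bar R)%E by rewrite lte_fin; lra.
  have := cv _ (open_ereal_gt' lt1).
  move=> [n _ /(_ n (leqnn n))] /=; rewrite bmf_EFin// lte_fin => /ltW ?.
  by exists n.
exists (rho K); split => //.
  have := lower K (fun=> 1) (bmf_cst _ _) (fun=> ler01).
  rewrite bint_cst; apply: le_trans; apply: ler_bint => // [|x]; last by rewrite mulr1.
  by apply: bmfM => //; exact: bmf_cst.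
move=> u C mu_ uC; have bu : bmf u by exact: bmf_le uC.
have bC : bmf (fun _ : T => C) by exact: bmf_cst.
have C0 x : - C <= u x <= C by have := uC x; rewrite ler_norml.
have := lower K (fun x => C + u x) (bmfD bC bu) _.
have := lower K (fun x => C - u x) (bmfB bC bu) _.
rewrite (bintB mu bC bu) (bintD mu bC bu) !bint_cst.
rewrite (_ : (fun x => rho K x * (C - u x)) = (fun x => C * rho K x - rho K x * u x)); last first.
  by apply/funext => x; rewrite mulrBr mulrC.
rewrite (_ : (fun x => rho K x * (C + u x)) = (fun x => C * rho K x + rho K x * u x)); last first.
  by apply/funext => x; rewrite mulrDr mulrC.
rewrite bintB ?bintD ?bintZ//; try exact: bmfZ; try exact: bmfM.
move=> H1 H2.
have {}H1 := H1 (fun x => ltac:(have := C0 x; lra)).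
have {}H2 := H2 (fun x => ltac:(have := C0 x; lra)).
have C_ge0 : 0 <= C by exact: le_trans (normr_ge0 _) (ler_norm_bintP mu mu_ uC).
have := ler_wpM2l C_ge0 HK; rewrite mulrBr mulr1 => H3.
by rewrite ler_norml; lra.
Unshelve. all: by end_near.
Qed.

End bounded_density.

(** * Partition of unity *)

Lemma continuous_measurable_borel (R : realType) (X : ptopologicalType) (f : X -> R) :
  continuous f -> measurable_fun setT (f : borel X -> R).
Proof.
move=> cf; apply: (measurability _ (RGenOInfty.measurableE R)).
move=> _ [_ [x ->] <-]; rewrite setTI; apply: sub_sigma_algebra.
by apply: open_comp => // y _; exact: cf.
Qed.

Section partition.
Context (R : realType) (X : ptopologicalType).
Variables (w : nat -> X -> R).
Hypothesis w01 : forall k x, 0 <= w k x <= 1.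
Hypothesis cw : forall k, continuous (w k).
Hypothesis w_cover : forall x : X, exists k, nbhs x [set y | w k y = 1].

(** Product of the 1 - w_k for k < L: the mass that the first [L] tents leave undistributed. It
    vanishes for good as soon as one w_k equals 1, whence local finiteness. *)
Fixpoint residual L x : R := if L is l.+1 then residual l x * (1 - w l x) else 1.

Definition tent k x : R := w k x * residual k x.

Lemma residual_ge0 L x : 0 <= residual L x.
Proof.
elim: L => [|L IH] /=; first exact: ler01.
by rewrite mulr_ge0// subr_ge0; case/andP: (w01 L x).
Qed.

Lemma tent_ge0 k x : 0 <= tent k x.
Proof. by rewrite mulr_ge0 ?residual_ge0//; case/andP: (w01 k x). Qed.

Lemma tentE k x : tent k x = residual k x - residual k.+1 x.
Proof. by rewrite /tent /=; lra. Qed.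

Lemma residual_le L L' x : (L <= L')%N -> residual L' x <= residual L x.
Proof.
elim: L' => [|n IH]; first by rewrite leqn0 => /eqP ->.
rewrite leq_eqVlt => /predU1P[->//|]; rewrite ltnS => /IH; apply: le_trans.
by have := tentE n x; have := tent_ge0 n x; lra.
Qed.

Lemma residual_le1 L x : residual L x <= 1.
Proof. exact: (@residual_le 0). Qed.

Lemma sum_tent L x : \sum_(k < L) tent k x = 1 - residual L x.
Proof.
elim: L => [|L IH]; first by rewrite big_ord0 /= subrr.
by rewrite big_ord_recr/= IH tentE/=; lra.
Qed.

Lemma continuous_residual L : continuous (residual L).
Proof.
elim: L => [|L IH] x /=; first exact: cvg_cst.
by apply: cvgM; [exact: IH|apply: cvgB; [exact: cvg_cst|exact: cw]].
Qed.

Lemma continuous_tent k : continuous (tent k).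
Proof. by move=> x; apply: cvgM; [exact: cw|exact: continuous_residual]. Qed.

Lemma residual_near0 (x : X) : exists L, nbhs x [set y | residual L y = 0].
Proof.
have [k wk] := w_cover x; exists k.+1.
by apply: filterS wk => y /= ->; rewrite subrr mulr0.
Qed.

Lemma residual_cvg0 x : exists L, residual L x = 0.
Proof. by have [L /nbhs_singleton] := residual_near0 x; exists L. Qed.

Definition signed_sum (c : nat -> bool) L x : R := \sum_(k < L) bsign R (c k) * tent k x.

Lemma signed_sum_dist c L L' x : (L <= L')%N ->
  `|signed_sum c L' x - signed_sum c L x| <= residual L x - residual L' x.
Proof.
elim: L' => [|n IH].
  by rewrite leqn0 => /eqP ->; rewrite !subrr normr0.
rewrite leq_eqVlt => /predU1P[->|]; first by rewrite !subrr normr0.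
rewrite ltnS => /IH H; rewrite /signed_sum big_ord_recr/= -/(signed_sum c n x) addrAC.
apply: (le_trans (ler_normD _ _)).
rewrite normrM norm_bsign mul1r (ger0_norm (tent_ge0 _ _)).
by have := tentE n x; rewrite /=; lra.
Qed.

(** The infinite signed sum of tents, stopped at a rank where the residual at [x] is 0. All later
    tents vanish at [x], so any such rank gives the same value. *)
Definition signed_limit (c : nat -> bool) x : R :=
  signed_sum c (projT1 (cid (residual_cvg0 x))) x.

Lemma signed_limit_dist c L x : `|signed_limit c x - signed_sum c L x| <= residual L x.
Proof.
rewrite /signed_limit; case: cid => L0 /= r0; have r_ge0 := residual_ge0 L x.
case: (leqP L L0) => LL0.
  by have := signed_sum_dist c x LL0; rewrite r0 subr0.
have := signed_sum_dist c x (ltnW LL0); rewrite r0 distrC.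
lra.
Qed.

Lemma norm_signed_limit c x : `|signed_limit c x| <= 1.
Proof. by have := signed_limit_dist c 0 x; rewrite /signed_sum big_ord0 subr0. Qed.

Lemma continuous_signed_sum c L : continuous (signed_sum c L).
Proof.
elim: L => [|L IH].
  rewrite (_ : signed_sum c 0 = cst 0); first by move=> x; exact: cvg_cst.
  by apply/funext => x; rewrite /signed_sum big_ord0.
rewrite (_ : signed_sum c L.+1 = fun x => signed_sum c L x + bsign R (c L) * tent L x).
  move=> x; apply: cvgD; first exact: IH.
  by apply: cvgM; [exact: cvg_cst|exact: continuous_tent].
by apply/funext => x; rewrite /signed_sum big_ord_recr.
Qed.

(** Near [x] the residual of some rank [L] is identically 0, so the limit coincides there with a
    finite sum. *)
Lemma continuous_signed_limit c : continuous (signed_limit c).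
Proof.
move=> x; have [L nL] := residual_near0 x.
have E : {near x, signed_sum c L =1 signed_limit c}.
  apply: filterS nL => y /= ry; have := signed_limit_dist c L y.
  by rewrite ry normr_le0 subr_eq0 => /eqP ->.
rewrite /continuous_at -(nbhs_singleton E).
apply: cvg_trans; first exact: near_eq_cvg E.
exact: continuous_signed_sum.
Qed.

(** Only tents with [w k x != 0] contribute, and there [phi x] is close to [phi (xs k)]; the mass
    missing from the first [L] tents costs [M * residual L x]. *)
Lemma partition_approx (phi : X -> R) (xs : nat -> X) eps M L x :
  (forall k, w k x != 0 -> `|phi x - phi (xs k)| <= eps) -> 0 <= eps ->
  `|phi x| <= M ->
  `|phi x - \sum_(k < L) phi (xs k) * tent k x| <= eps + M * residual L x.
Proof.
move=> phiw eps0 phiM.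
have -> : phi x - \sum_(k < L) phi (xs k) * tent k x =
    \sum_(k < L) (phi x - phi (xs k)) * tent k x + phi x * residual L x.
  under [in RHS]eq_bigr do rewrite mulrBl.
  by rewrite sumrB -mulr_sumr sum_tent; lra.
apply: (le_trans (ler_normD _ _)); apply: lerD; last first.
  by rewrite normrM (ger0_norm (residual_ge0 _ _)) ler_wpM2r// residual_ge0.
apply: (le_trans (ler_norm_sum _ _ _)).
apply: (@le_trans _ _ (\sum_(k < L) eps * tent k x)).
  apply: ler_sum => k _; rewrite normrM (ger0_norm (tent_ge0 _ _)).
  have [w0|w0] := eqVneq (w k x) 0; first by rewrite /tent w0 mul0r !mulr0.
  by rewrite ler_wpM2r ?tent_ge0// phiw.
rewrite -mulr_sumr sum_tent ler_piMr// gerBl; exact: residual_ge0.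
Qed.

End partition.

(** * A partition adapted to an equicontinuous family *)

Section equicontinuous_family.
Context (R : realType) (X : ptopologicalType) (Fam : set (X -> R)) (M : R) (D : set X).
Hypothesis FamM : forall phi, Fam phi -> forall x, `|phi x| <= M.
Hypothesis Fam0 : Fam !=set0.
Hypothesis Fam_equi : forall (x : X) e, 0 < e ->
  nbhs x [set y | forall phi, Fam phi -> `|phi y - phi x| <= e].
Hypothesis countD : countable D.
Hypothesis denseD : closure D = setT.

(** A pseudometric for which every member of the family is 1-Lipschitz. Equicontinuity says that it
    is continuous on [X], so bumps built from it are continuous and serve the whole family at
    once. *)
Let osc a x : R := sup [set `|phi a - phi x| | phi in Fam].

Let osc_ub a x phi : Fam phi -> `|phi a - phi x| <= osc a x.
Proof.
move=> Fphi; apply: ub_le_sup; last by exists phi.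
exists (M + M) => _ [psi Fpsi <-].
by rewrite (le_trans (ler_normB _ _))// lerD// FamM.
Qed.

Let osc_le a x c : (forall phi, Fam phi -> `|phi a - phi x| <= c) -> osc a x <= c.
Proof.
move=> H; apply: ge_sup; first by have [phi Fphi] := Fam0; exists `|phi a - phi x|, phi.
by move=> _ [phi Fphi <-]; exact: H.
Qed.

Let osc_sym a x : osc a x = osc x a.
Proof.
by apply/eqP; rewrite eq_le; apply/andP; split; apply: osc_le => phi Fphi;
  rewrite distrC; exact: osc_ub.
Qed.

Let osc_triangle a b x : osc a x <= osc a b + osc b x.
Proof.
apply: osc_le => phi Fphi.
by rewrite (le_trans (ler_distD (phi b) _ _))// lerD//; exact: osc_ub.
Qed.

Let osc_near (x : X) e : 0 < e -> nbhs x [set y | osc y x <= e].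
Proof.
by move=> e0; apply: filterS (Fam_equi x e0) => y /= H; exact: osc_le.
Qed.

Lemma equicontinuous_partition (eps : R) : 0 < eps ->
  exists (xs : nat -> X) (w : nat -> X -> R),
    [/\ (forall k x, 0 <= w k x <= 1), (forall k, continuous (w k)),
        (forall x : X, exists k, nbhs x [set y | w k y = 1]) &
        forall phi k x, Fam phi -> w k x != 0 -> `|phi x - phi (xs k)| <= eps].
Proof.
move=> eps0; have /countable_injP[e e_inj] := countD.
(* [e] injects the dense set into the indices. An index outside its range gets the centre [point],
   which does no harm: the bump around any centre has the required properties. *)
pose xs k := xget point [set d | D d /\ e d = k].
have xsD d : D d -> xs (e d) = d.
  move=> Dd; have [Dx ex] : [set d' | D d' /\ e d' = e d] (xs (e d)) by exact: (xgetI _ (x := d)).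
  by apply: e_inj => //; exact/mem_set.
pose clip (t : R) := Num.max 0 (Num.min 1 t).
have clip01 t : 0 <= clip t <= 1.
  rewrite /clip le_max lexx/= ge_max ler01/= ge_min lexx//.
have clip_lip s t : `|clip s - clip t| <= `|s - t|.
  have clipE u : [\/ u <= 0 /\ clip u = 0, 0 <= u <= 1 /\ clip u = u | 1 <= u /\ clip u = 1].
    have [u0|/ltW u0] := leP u 0; last have [u1|/ltW u1] := leP u 1.
    - apply: Or31; split => //; rewrite /clip; apply/max_idPl.
      by rewrite ge_min u0 orbT.
    - apply: Or32; split; first exact/andP.
      by rewrite /clip (min_idPr _)// (max_idPr _).
    - by apply: Or33; split => //; rewrite /clip (min_idPl _)// (max_idPr _).
  have := ler_norm (s - t); have := ler_norm (t - s); rewrite (distrC t s) ler_norml.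
  by have [[? ->]|[? ->]|[? ->]] := clipE s; have [[? ->]|[? ->]|[? ->]] := clipE t; lra.
(* The bump is 1 where the oscillation from [xs k] is at most eps / 2 and 0 where it is at least
   eps. *)
pose w k x := clip (2 - 2 / eps * osc (xs k) x).
have c0 : 0 < 2 / eps by rewrite divr_gt0.
have ceps : 2 / eps * eps = 2 by rewrite divfK// gt_eqF.
exists xs, w; split.
- by move=> k x; exact: clip01.
- move=> k x; apply/cvgrPdist_le => t t0.
  have tc0 : 0 < t / (2 / eps) by exact: divr_gt0.
  apply: filterS (osc_near x tc0) => y /= Hy; apply: (le_trans (clip_lip _ _)).
  have -> : 2 - 2 / eps * osc (xs k) x - (2 - 2 / eps * osc (xs k) y) =
    2 / eps * (osc (xs k) y - osc (xs k) x) by rewrite mulrBr; lra.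
  rewrite normrM (gtr0_norm c0) mulrC -ler_pdivlMr//; apply: le_trans Hy.
  have := osc_triangle (xs k) x y; have := osc_triangle (xs k) y x.
  by rewrite (osc_sym x y) ler_norml; lra.
(* With a dense point within eps / 4 of [x], all y within eps / 4 of [x] are within eps / 2 of that
   point, where its bump is 1. *)
- move=> x; have e4 : 0 < eps / 4 by rewrite divr_gt0.
  have nx := osc_near x e4.
  have [d [Dd dx]] : D `&` [set y | osc y x <= eps / 4] !=set0.
    by have /(_ _ nx) : closure D x by rewrite denseD.
  exists (e d); apply: filterS nx => y /= yx; rewrite /w xsD// /clip.
  have dy : osc d y <= eps / 2.
    by have := osc_triangle d x y; rewrite (osc_sym x y) /= in dx *; lra.
  have : 2 / eps * osc d y <= 1.
    by have := ler_wpM2l (ltW c0) dy; rewrite mulrA ceps; lra.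
  move=> H; have /min_idPl -> : 1 <= 2 - 2 / eps * osc d y by lra.
  by apply/max_idPr; exact: ler01.
- move=> phi k x Fphi wx; rewrite (le_trans (osc_ub _ _ Fphi))// osc_sym leNgt.
  apply/negP => H; move/eqP: wx; apply; rewrite /w /clip.
  have : 2 < 2 / eps * osc (xs k) x by rewrite -{1}ceps ltr_pM2l.
  move=> H2; apply/max_idPl; rewrite ge_min; apply/orP; right; lra.
Qed.

End equicontinuous_family.

(** If [A] is not a neighbourhood of [x0], points outside [A] at distance below 1 / (n + 1) converge
    to [x0]. This turns the sequential form of total variation continuity into a statement on
    neighbourhoods. *)
Lemma polish_nbhs_seq (R : realType) (X : topologicalType) (x0 : X) (A : set X) :
  polish R X -> (forall a : nat -> X, a n @[n --> \oo] --> x0 -> exists n, A (a n)) ->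
  nbhs x0 A.
Proof.
move=> [_ [dist [dist0 dist_sym dist_tri openE' _]]] seqA.
have ball_nbhs e : 0 < e -> nbhs x0 [set y | dist x0 y < e].
  move=> e0; apply: open_nbhs_nbhs; split; last by rewrite /= (dist0 x0 x0).2.
  apply/openE' => x /= xe; exists (e - dist x0 x); first by rewrite subr_gt0.
  by move=> y /= xy; rewrite (le_lt_trans (dist_tri _ x _))// -ltrBrDl.
apply: contrapT => nA.
have step (n : nat) : exists y, dist x0 y < n.+1%:R^-1 /\ ~ A y.
  apply: contrapT => H; apply: nA.
  apply: filterS (ball_nbhs n.+1%:R^-1 _) => [y /= yn|]; last by rewrite invr_gt0.
  by apply: contrapT => Ay; apply: H; exists y.
have [a aP] := choice step.
have [|n] := seqA a; last by have [] := aP n.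
move=> B; rewrite /= nbhsE; case=> O [oO Ox0] OB.
have [e e0 eO] := (openE' O).1 oO x0 Ox0.
have : \forall n \near \oo, (n.+1%:R^-1 : R) < e.
  exact: near_infty_natSinv_lt (PosNum e0).
apply: filterS => n ne; apply/OB/eO => /=.
by apply: lt_trans ne; have [] := aP n.
Qed.

(** * Equicontinuity from total variation continuity of the channel *)

Section channel.
Context (R : realType) (X Y Z : ptopologicalType).
Variables (Q : probability (borel Z) R) (h : X -> Z -> Y).
Hypothesis mh : measurable_fun setT (fun p : borel X * borel Z => (h p.1 p.2 : borel Y)).

Lemma measurable_channel x : measurable_fun setT (h x : borel Z -> borel Y).
Proof. exact: (measurableT_comp mh (pair1_measurable (x : borel X))). Qed.

(** Once the past observations are fixed, the sign of the filter gap is a function [s] of the last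
    observation alone; so this family contains the function phi for every n and every past. *)
Definition channel_family (f : X -> R) : set (X -> R) :=
  [set phi | exists s : borel Y -> R, [/\ measurable_fun setT s,
     (forall y, `|s y| <= 1) & phi = fun x => f x * \int[Q]_z s (h x z)]].

Lemma channel_family_le f M phi x : (forall x, `|f x| <= M) ->
  channel_family f phi -> `|phi x| <= M.
Proof.
move=> fM [s [ms s1 ->]]; rewrite normrM -[leRHS]mulr1 ler_pM//.
apply: ler_norm_bintP => //; exact: (measurableT_comp ms (measurable_channel x)).
Qed.

Lemma TV_channel_ge a x (s : borel Y -> R) (c : R) : measurable_fun setT s ->
  (forall y, `|s y| <= 1) ->
  (TV (pushforward Q (h a : borel Z -> borel Y)) (pushforward Q (h x : borel Z -> borel Y))
     < c%:E)%E ->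
  `|\int[Q]_z s (h a z) - \int[Q]_z s (h x z)| < c.
Proof.
move=> ms s1 TVc; rewrite -lte_fin; apply: le_lt_trans TVc.
have push b : (\int[pushforward Q (h b : borel Z -> borel Y)]_y (s y)%:E =
    (\int[Q]_z s (h b z))%:E)%E.
  have bs : bmf (fun z : borel Z => s (h b z)).
    apply: (@bmf_le _ _ _ _ 1) => //.
    exact: (measurableT_comp ms (measurable_channel b)).
  rewrite integral_pushforward//=; last 3 first.
  - exact: measurable_channel.
  - exact/measurable_EFinP.
  - exact: bmf_integrable.
  by rewrite bmf_EFin.
by apply: ereal_sup_ubound; exists s => //; rewrite !push.
Qed.

(** Each [s] is a test function for the total variation distance, so the channel averages of all [s]
    vary by a common small amount; the variation of the factor [f] is controlled by its
    continuity. *)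
Lemma channel_family_equicontinuous (f : X -> R) M x e : polish R X ->
  tv_continuous_channel Q h -> continuous f -> (forall x, `|f x| <= M) -> 0 < e ->
  nbhs x [set y | forall phi, channel_family f phi -> `|phi y - phi x| <= e].
Proof.
move=> pX tvc cf fM e0; apply: polish_nbhs_seq pX _ => a ax.
have M1 : 0 < `|M| + 1 by rewrite ltr_wpDl.
have c0 : 0 < e / 2 / (`|M| + 1) by rewrite !divr_gt0.
have e2 : 0 < e / 2 by rewrite divr_gt0.
have nf : \forall n \near \oo, `|f x - f (a n)| < e / 2.
  have fa : f (a n) @[n --> \oo] --> f x by apply: cvg_comp ax _; exact: cf.
  by move/cvgrPdist_lt : fa; exact.
have nTV : \forall n \near \oo,
  (TV (pushforward Q (h (a n) : borel Z -> borel Y))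
      (pushforward Q (h x : borel Z -> borel Y)) < (e / 2 / (`|M| + 1))%:E)%E.
  have c0' : (0%:E < (e / 2 / (`|M| + 1))%:E)%E by rewrite lte_fin.
  exact: (tvc _ _ ax _ (open_ereal_lt' c0')).
have [n _ /(_ n (leqnn n)) [fn tn]] := filterI nf nTV.
exists n => phi [s [ms s1 ->]].
have := TV_channel_ge ms s1 tn.
set I1 := \int[Q]_z _; set I2 := \int[Q]_z _ => I12.
have I2_1 : `|I2| <= 1.
  apply: ler_norm_bintP => //; exact: (measurableT_comp ms (measurable_channel x)).
have -> : f (a n) * I1 - f x * I2 = f (a n) * (I1 - I2) - (f x - f (a n)) * I2.
  by rewrite mulrBr mulrBl; lra.
rewrite (le_trans (ler_normB _ _))// (splitr e) lerD//.
  rewrite normrM; apply: (@le_trans _ _ ((`|M| + 1) * (e / 2 / (`|M| + 1)))).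
    rewrite ler_pM// ?ltW//; have := fM (a n); have := ler_norm M; lra.
  by rewrite mulrC divfK// gt_eqF.
by rewrite normrM -[leRHS]mulr1 ler_pM// ltW.
Qed.

End channel.

(** * Markov property *)

Section markov.
Context (R : realType) (X Y Z : ptopologicalType).
Variables (T : R.-pker (borel X) ~> (borel X)) (Q : probability (borel Z) R).
Variable h : X -> Z -> Y.
Hypothesis mh : measurable_fun setT (fun p : borel X * borel Z => (h p.1 p.2 : borel Y)).
Context d (Om : measurableType d) (P : probability Om R) (mu : probability (borel X) R).
Variables (Xs : nat -> Om -> X) (Zs : nat -> Om -> Z).
Hypothesis proc : hmm_process T Q P mu Xs Zs.
Local Notation K := (traj_law T Q).
Local Notation tr := (traj_of Xs Zs).
Local Notation W := (obsseq h Xs Zs).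

Lemma hmm_markov n N (G : traj X Z (n.+1 + N) -> R) : bmf G ->
  \int[P]_w G (tr w) = \int[P]_w \int[K N (Xs n.+1 w)]_r G (splice n.+1 (tr w) r).
Proof.
move=> bG; apply: (etrans (@hmm_law _ _ _ _ _ _ _ _ _ _ _ proc (n + N) G bG)).
transitivity (\int[mu]_x \int[K n.+2 x]_s \int[K N (s n.+1).1]_r G (splice n.+1 s r)).
  by apply: eq_Rintegral => x _; exact: (@bint_K_split _ _ _ T Q n.+1 N x G bG).
exact/esym/(hmm_law proc (bmf_continuation T Q bG)).
Qed.

(** Under the trajectory law from [x] the state at time 0 is [x] itself, so the factor [rho] comes
    out of the inner integral. *)
Lemma hmm_law_start n (rho : borel X -> R) (G : traj X Z n.+1 -> R) : bmf rho -> bmf G ->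
  \int[P]_w (rho (Xs 0%N w) * G (tr w)) = \int[mu]_x (rho x * \int[K n.+1 x]_s G s).
Proof.
move=> brho bG.
have brs : bmf (fun s : traj X Z n.+1 => rho (s 0%N).1).
  by have := bmf_comp (@measurable_state X Z n.+1 0 isT) brho.
rewrite (hmm_law proc (bmfM brs bG)); apply: eq_Rintegral => x _.
rewrite bint_KS ?bint_KS//; last exact: bmfM.
have bG0 : bmf (fun p : borel Z * traj X Z n => G (tcons (x, p))).
  have := bmf_comp (@measurable_tcons _ _ n) bG.
  by move=> /(bmf_comp (@pair1_measurable _ _ _ _ (x : borel X))).
have bK : bmf (fun p : borel Z * borel X => \int[K n p.2]_s G (tcons (x, (p.1, s)))).
  exact: (bmf_gint2 (measurable_K T Q n) bG0).
rewrite -bintZ; last exact: (bmf_section_int (giry_of_pker T x) bK).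
apply: eq_Rintegral => z _; rewrite -bintZ; last first.
  by have := bmf_comp (@pair1_measurable _ _ _ _ (z : borel Z)) bK.
apply: eq_Rintegral => x' _; rewrite -bintZ//.
by have := bmf_comp (@pair1_measurable _ _ _ _ (z : borel Z)) bG0.
Qed.

Variables (n : nat) (rho : borel X -> R) (a : (nat -> Y) -> R).
Hypothesis brho : bmf rho.
Hypothesis ba : bmf (a : obs (borel Y) n.+1 -> R).

Let measurable_Xs i : measurable_fun setT (Xs i : Om -> borel X).
Proof. by case: proc. Qed.

Let a_splice (s r : nat -> X * Z) : a (ymap h (splice n.+1 s r)) = a (ymap h s).
Proof.
have [ma _] := ba; apply: (obs_measurable_ext ma) => i ni.
by rewrite /ymap splice_lt.
Qed.

(** Restart at time [n.+1]: the factor in front depends only on times up to [n], so the conditional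
    mean given the state may be replaced by the actual observations, beginning with the one at time
    [n.+1] itself. *)
Lemma bint_future N (g : (nat -> Y) -> R) : bmf (g : obs (borel Y) N -> R) ->
  \int[P]_w (rho (Xs 0%N w) * a (W w) * \int[K N (Xs n.+1 w)]_r g (ymap h r)) =
  \int[P]_w (rho (Xs 0%N w) * a (W w) * g (fun i => W w (n.+1 + i)%N)).
Proof.
move=> bg.
pose G (s : nat -> X * Z) := rho (s 0%N).1 * a (ymap h s) * g (fun i => ymap h s (n.+1 + i)%N).
have bG : bmf (G : traj X Z (n.+1 + N) -> R).
  apply: bmfM.
    apply: bmfM.
      by have := bmf_comp (@measurable_state X Z (n.+1 + N) 0 isT) brho.
    by have := bmf_comp (measurable_ymap mh (leq_addr N n.+1)) ba.
  have mg : measurable_fun setT (fun s : traj X Z (n.+1 + N) =>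
      (fun i => ymap h s (n.+1 + i)%N) : obs (borel Y) N).
    apply: measurable_obs => i iN.
    have ni : (n.+1 + i < n.+1 + N)%N by rewrite ltn_add2l.
    apply: (measurableT_comp mh (_ : measurable_fun setT (fun s : traj X Z (n.+1 + N) =>
      ((s (n.+1 + i)%N).1 : borel X, (s (n.+1 + i)%N).2 : borel Z)))).
    by apply: measurable_fun_pair; [exact: measurable_state|exact: measurable_noise].
  by have := bmf_comp mg bg.
rewrite [RHS](hmm_markov bG); apply: eq_Rintegral => w _.
have bgr : bmf (fun r : traj X Z N => g (ymap h r)).
  by have := bmf_comp (measurable_ymap mh (leqnn N)) bg.
rewrite -bintZ//; apply: eq_Rintegral => r _; rewrite /G splice_lt// a_splice.
congr (_ * g _); apply/funext => i.
by rewrite /ymap splice_add.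
Qed.

(** Restart at time [n.+1] for a single coordinate: only the noise is fresh there, and averaging
    over it replaces the last observation in [s]. *)
Lemma bint_channel (s : (nat -> Y) -> R) (f : borel X -> R) :
  bmf (s : obs (borel Y) n.+2 -> R) -> bmf f ->
  \int[P]_w (rho (Xs 0%N w) * a (W w) * (s (W w) * f (Xs n.+1 w))) =
  \int[P]_w (rho (Xs 0%N w) * a (W w) * (f (Xs n.+1 w) *
      \int[Q]_z s (splice n.+1 (W w) (fun=> h (Xs n.+1 w) z)))).
Proof.
move=> bs bf.
pose G (t : nat -> X * Z) := rho (t 0%N).1 * a (ymap h t) * (s (ymap h t) * f (t n.+1).1).
have le2 : (n.+2 <= n.+1 + 1)%N by rewrite addn1.
have bG : bmf (G : traj X Z (n.+1 + 1) -> R).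
  apply: bmfM; apply: bmfM.
  - by have := bmf_comp (@measurable_state X Z (n.+1 + 1) 0 isT) brho.
  - by have := bmf_comp (measurable_ymap mh (ltnW le2)) ba.
  - by have := bmf_comp (measurable_ymap mh le2) bs.
  - by have := bmf_comp (@measurable_state X Z (n.+1 + 1) n.+1 le2) bf.
rewrite [LHS](hmm_markov bG); apply: eq_Rintegral => w _.
have bGr : bmf (fun r : traj X Z 1 => G (splice n.+1 (tr w) r)).
  have := bmf_comp (@measurable_splice X Z n.+1 n.+1 1 (leqnn _)) bG.
  by move=> /(bmf_comp (@pair1_measurable _ _ (traj X Z n.+1) (traj X Z 1) (tr w))).
have bsz : bmf (fun z : borel Z => s (splice n.+1 (W w) (fun=> h (Xs n.+1 w) z))).
  have mz : measurable_fun setT (fun z : borel Z =>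
      splice n.+1 (W w) (fun=> h (Xs n.+1 w) z) : obs (borel Y) n.+2).
    apply: measurable_obs => i ni; rewrite /splice; case: (i < n.+1)%N => //.
    exact: (measurableT_comp mh (pair1_measurable (Xs n.+1 w : borel X))).
  by have := bmf_comp mz bs.
rewrite bint_KS// !mulrA -bintZ//; apply: eq_Rintegral => z _.
rewrite -[RHS](giry_of_pker_cst T (Xs n.+1 w)); apply: eq_Rintegral => x' _.
rewrite -[RHS](bint_K_cst T Q 0 x'); apply: eq_Rintegral => r _.
rewrite /G splice_lt// a_splice splice_at /= -!mulrA; congr (_ * (_ * _)).
rewrite mulrC; congr (_ * _); have [ms _] := bs.
apply: (obs_measurable_ext ms) => i; rewrite ltnS leq_eqVlt => /predU1P[->|ni].
  by rewrite /ymap !splice_at.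
by rewrite /ymap !splice_lt.
Qed.

End markov.

(** * The gliding-hump estimate *)

Section conditional_observation.
Context (R : realType) (X Y Z : ptopologicalType).
Variables (T : R.-pker (borel X) ~> (borel X)) (Q : probability (borel Z) R).
Variable h : X -> Z -> Y.
Hypothesis mh : measurable_fun setT (fun p : borel X * borel Z => (h p.1 p.2 : borel Y)).

Definition cond N (g : (nat -> Y) -> R) (x : X) : R := \int[traj_law T Q N x]_r g (ymap h r).

Lemma bmf_cond N g : bmf (g : obs (borel Y) N -> R) -> bmf (cond N g : borel X -> R).
Proof.
move=> bg; apply: bmf_gint; first exact: measurable_K.
by have := bmf_comp (measurable_ymap mh (leqnn N)) bg.
Qed.

Lemma observable_approx : observable T Q h -> exists N, forall f : X -> R, continuous f ->
  (exists M, forall x, `|f x| <= M) -> forall eps, 0 < eps ->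
  exists g : (nat -> Y) -> R, bmf (g : obs (borel Y) N -> R) /\
    forall x, `|f x - cond N g x| <= eps.
Proof.
move=> [N obsN]; exists N => f cf fM eps eps0.
have [g [mg gM supg]] := obsN f cf fM eps eps0; have bg : bmf g by split.
exists g; split => // x; rewrite -lee_fin; apply: le_trans (ltW supg).
by apply: ereal_sup_ubound; exists x => //; rewrite cond_obsE.
Qed.

End conditional_observation.

Section hump_estimate.
Context (R : realType) (X Y Z : ptopologicalType).
Variables (T : R.-pker (borel X) ~> (borel X)) (Q : probability (borel Z) R).
Variable h : X -> Z -> Y.
Hypothesis mh : measurable_fun setT (fun p : borel X * borel Z => (h p.1 p.2 : borel Y)).
Variable N : nat.
Local Notation cond := (cond T Q h N).
Hypothesis obsN : forall f : X -> R, continuous f ->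
  (exists M, forall x, `|f x| <= M) -> forall eps, 0 < eps ->
  exists g : (nat -> Y) -> R, bmf (g : obs (borel Y) N -> R) /\
    forall x, `|f x - cond g x| <= eps.
Variable w : nat -> X -> R.
Hypothesis w01 : forall k x, 0 <= w k x <= 1.
Hypothesis cw : forall k, continuous (w k).
Hypothesis w_cover : forall x : X, exists k, nbhs x [set y | w k y = 1].
Local Notation tent := (tent w).
Local Notation residual := (residual w).
Local Notation signed_sum := (signed_sum w).

Lemma tent_le1 k x : `|tent k x| <= 1.
Proof.
rewrite ger0_norm ?tent_ge0//; have := tentE w k x; have := residual_ge0 w01 k.+1 x.
have := residual_le1 w01 k x; lra.
Qed.

Lemma bmf_tent k : bmf (tent k : borel X -> R).
Proof.
apply: (@bmf_le _ _ _ _ 1) => [|x]; last exact: tent_le1.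
apply: continuous_measurable_borel; exact: continuous_tent.
Qed.

Lemma bmf_residual L : bmf (residual L : borel X -> R).
Proof.
apply: (@bmf_le _ _ _ _ 1) => [|x].
  by apply: continuous_measurable_borel; exact: continuous_residual.
by rewrite ger0_norm; [exact: residual_le1|exact: residual_ge0].
Qed.

(** The bound [C] on [g] is recorded because the error caused by the weight is [eta * C]. *)
Definition approximable (eps C : R) (f : X -> R) := exists g : (nat -> Y) -> R,
  [/\ measurable_fun setT (g : obs (borel Y) N -> R), (forall y, `|g y| <= C) &
      forall x, `|f x - cond g x| <= eps].

(** Integer bounds split the sign patterns into countably many classes, as the Baire argument
    requires. *)
Lemma approximable_nat eps (f : X -> R) : 0 < eps -> continuous f ->
  (exists M, forall x, `|f x| <= M) -> exists G : nat, approximable eps G%:R f.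
Proof.
move=> eps0 cf fM; have [g [[mg [C gC]] Hg]] := obsN cf fM eps0.
exists (Num.bound `|C|), g; split => // y; apply: le_trans (gC y) _.
exact/ltW/(le_lt_trans (ler_norm C))/archi_boundP.
Qed.

(** A pattern [c] that agrees with [s] below [L] has the same partial sum, and its full limit is at
    most [residual L x] away. So a bound valid on a dense set of patterns serves every [s] extending
    [c0], uniformly in [L]. *)
Lemma approximable_signed_sums eps : 0 < eps ->
  exists K c0 (G : nat), forall s, agree K s c0 -> forall L,
    exists g : (nat -> Y) -> R,
    [/\ measurable_fun setT (g : obs (borel Y) N -> R), (forall y, `|g y| <= G%:R) &
        forall x, `|signed_sum s L x - cond g x| <= eps + residual L x].
Proof.
move=> eps0.
have [|K [c0 [G H]]] :=
  @uniform_bound (fun G c => approximable eps G%:R (signed_limit w_cover c)).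
  move=> c; apply: approximable_nat => //; first exact: continuous_signed_limit.
  by exists 1; exact: norm_signed_limit.
exists K, c0, G => s sc0 L; have [c cs [g [mg gG Hg]]] := H s sc0 L.
exists g; split => // x.
have -> : signed_sum s L x = signed_sum c L x.
  by apply: eq_bigr => k _; rewrite cs.
rewrite (le_trans (ler_distD (signed_limit w_cover c x) _ _))// addrC lerD//.
by rewrite distrC signed_limit_dist.
Qed.

(** Serves the first [K] coefficients, whose signs are frozen by the pattern [c0]; being finitely
    many, these tents share one bound. *)
Lemma approximable_tents (K : nat) eps : 0 < eps ->
  exists C : R, 0 <= C /\ forall k, (k < K)%N -> approximable eps C (tent k).
Proof.
move=> eps0; elim: K => [|K [C [C0 IH]]]; first by exists 0.
have [|G [g [mg gG Hg]]] := approximable_nat eps0 (@continuous_tent _ _ _ cw K).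
  by exists 1; exact: tent_le1.
exists (C + G%:R); split; first by rewrite addr_ge0.
move=> k; rewrite ltnS leq_eqVlt => /predU1P[->|/IH [g' [mg' g'C Hg']]].
  by exists g; split => // y; rewrite (le_trans (gG y))// lerDr.
by exists g'; split => // y; rewrite (le_trans (g'C y))// lerDl.
Qed.

Section estimate.
Context d (Om : measurableType d) (P : probability Om R).
Variables (U : Om -> R) (xi : Om -> borel X) (n : nat) (v : Om -> obs (borel Y) n).
Variables (B eta M : R).
Hypothesis bU : bmf U.
Hypothesis UB : \int[P]_o `|U o| <= B.
Hypothesis mxi : measurable_fun setT xi.
Hypothesis mv : measurable_fun setT v.
Hypothesis M_gt0 : 0 < M.
Hypothesis small : forall (I : finType) (a g : I -> (nat -> Y) -> R) (C : R), 0 <= C ->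
  (forall i, bmf (a i : obs (borel Y) n -> R)) -> (forall y, \sum_i `|a i y| <= 1) ->
  (forall i, measurable_fun setT (g i : obs (borel Y) N -> R)) ->
  (forall i y, `|g i y| <= C) ->
  `|\int[P]_o (U o * \sum_i (a i (v o) * cond (g i) (xi o)))| <= eta * C.

Let bmf_past (a : (nat -> Y) -> R) : bmf (a : obs (borel Y) n -> R) -> bmf (fun o => a (v o)).
Proof. by move=> ba; have := bmf_comp mv ba. Qed.

Let bmf_state (a : X -> R) : bmf (a : borel X -> R) -> bmf (fun o => a (xi o)).
Proof. by move=> ba; have := bmf_comp mxi ba. Qed.

Let small_approx (F : Om -> R) (e : X -> R) (I : finType) (a g : I -> (nat -> Y) -> R) C :
  0 <= C -> bmf F -> bmf (e : borel X -> R) ->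
  (forall i, bmf (a i : obs (borel Y) n -> R)) -> (forall y, \sum_i `|a i y| <= 1) ->
  (forall i, measurable_fun setT (g i : obs (borel Y) N -> R)) ->
  (forall i y, `|g i y| <= C) ->
  (forall o, `|F o - \sum_i (a i (v o) * cond (g i) (xi o))| <= e (xi o)) ->
  `|\int[P]_o (U o * F o)| <= eta * C + \int[P]_o (`|U o| * e (xi o)).
Proof.
move=> C0 bF be ba a1 mg gC HF.
pose S o := \sum_i (a i (v o) * cond (g i) (xi o)).
have bS : bmf S.
  apply: bmf_sum => i _; apply: bmfM; first exact: bmf_past.
  apply/bmf_state/bmf_cond => //; exact: (@bmf_le _ _ _ _ C).
have -> : \int[P]_o (U o * F o) = \int[P]_o (U o * S o) + \int[P]_o (U o * (F o - S o)).
  rewrite -bintD; [|exact: bmfM|by apply: bmfM => //; exact: bmfB].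
  by apply: eq_Rintegral => o _; rewrite -mulrDr addrC subrK.
rewrite (le_trans (ler_normD _ _))// lerD//; first exact: small.
apply: ler_norm_bint => [||o].
- by apply: bmfM => //; exact: bmfB.
- by apply: bmfM; [exact: bmf_norm|exact: bmf_state].
by rewrite normrM ler_wpM2l.
Qed.

(** The first term comes from the mixture of signed sums, the second from correcting the first [K]
    coefficients: each correction is at most [2 * M], and the precision eps / (K + 1) keeps the
    total of [K] errors below eps. [L] occurs only in the residual, so the bounds [G] and [C]
    survive an arbitrarily late cut. *)
Lemma hump_estimate (eps C : R) (K G L : nat) (c0 : nat -> bool)
    (c : nat -> (nat -> Y) -> R) :
  0 < eps -> (K <= L)%N -> 0 <= C ->
  (forall s, agree K s c0 -> forall L, exists g : (nat -> Y) -> R,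
    [/\ measurable_fun setT (g : obs (borel Y) N -> R), (forall y, `|g y| <= G%:R) &
        forall x, `|signed_sum s L x - cond g x| <= eps + residual L x]) ->
  (forall k, (k < K)%N -> approximable (eps / K.+1%:R) C (tent k)) ->
  (forall k, bmf (c k : obs (borel Y) n -> R)) -> (forall k y, `|c k y| <= M) ->
  `|\int[P]_o (U o * \sum_(k < L) c k (v o) * tent k (xi o))| <=
    M * (eta * G%:R + B * eps + \int[P]_o (`|U o| * residual L (xi o)))
    + 2 * M * (K%:R * C * eta + B * eps).
Proof.
move=> eps0 KL C0 HG HC bc cM.
(* Below [K] the coefficients are replaced by the signs [c0], so that only the patterns
   extending [c0] have a nonzero weight; [e] is the correction. *)
pose r y k := if (k < K)%N then bsign R (c0 k) else c k y / M.
pose e k y := if (k < K)%N then M * bsign R (c0 k) - c k y else 0.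
have r1 y k : `|r y k| <= 1.
  rewrite /r; case: ifP => _; first by rewrite norm_bsign.
  by rewrite normrM normfV (gtr0_norm M_gt0) ler_pdivrMr// mul1r.
have re k y : c k y = M * r y k - e k y.
  rewrite /r /e; case: ifP => _; first by rewrite opprB addrC subrK.
  by rewrite subr0 mulrC divfK// gt_eqF.
have be k : bmf (e k : obs (borel Y) n -> R).
  rewrite /e; case: (k < K)%N; last exact: bmf_cst.
  by apply: bmfB => //; exact: bmf_cst.
have br k : bmf ((fun y => r y k) : obs (borel Y) n -> R).
  rewrite /r; case: (k < K)%N; first exact: bmf_cst.
  by apply: bmfM => //; exact: bmf_cst.
have eM k y : `|e k y| <= 2 * M.
  rewrite /e; case: ifP => _; last by rewrite normr0 mulr_ge0// ltW.
  rewrite (le_trans (ler_normB _ _))// normrM norm_bsign mulr1 (gtr0_norm M_gt0).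
  by have := cM k y; lra.
(* The default [false] is never read: sums stop at [L], and [K] is at most [L]. *)
pose ext (s : {ffun 'I_L -> bool}) (k : nat) := if insub k is Some i then s i else false.
have extE s (i : 'I_L) : ext s i = s i by rewrite /ext valK.
pose wt (s : {ffun 'I_L -> bool}) y := sign_weight (r y) s.
have wt_agree s y : wt s y != 0 -> agree K (ext s) c0.
  move=> wt0 k kK; apply/eqP; apply: contraNT wt0 => sk.
  rewrite /wt /sign_weight (bigD1 (Ordinal (leq_trans kK KL)))//= /r kK.
  move: sk; rewrite -(extE s (Ordinal (leq_trans kK KL))) /= /bsign.
  by case: (ext s k); case: (c0 k) => // _; rewrite (_ : (_ + _) / 2 = 0) ?mul0r//; lra.
have bwt s : bmf (wt s : obs (borel Y) n -> R).
  apply: bmf_prod => i; apply: bmfM; last exact: bmf_cst.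
  by apply: bmfD; [exact: bmf_cst|exact: bmfZ].
(* A pattern that does not extend [c0] has weight 0, so [g = 0] will do for it. *)
have pat s : exists g : (nat -> Y) -> R,
    [/\ measurable_fun setT (g : obs (borel Y) N -> R), (forall y, `|g y| <= G%:R) &
      agree K (ext s) c0 -> forall x, `|signed_sum (ext s) L x - cond g x| <= eps + residual L x].
  have [/HG /(_ L) [g [mg gG Hg]]|na] := pselect (agree K (ext s) c0).
    by exists g; split.
  by exists (fun=> 0); split => // y; rewrite normr0.
have [g gP] := choice pat.
have mixE y x : \sum_(k < L) r y k * tent k x = \sum_s wt s y * signed_sum (ext s) L x.
  under [RHS]eq_bigr do rewrite mulr_sumr.
  rewrite exchange_big/=; apply: eq_bigr => k _.
  rewrite -(sign_weight_mean (r y) k) mulr_suml; apply: eq_bigr => s _.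
  by rewrite extE mulrA.
have bmix : bmf (fun o => \sum_(k < L) r (v o) k * tent k (xi o)).
  apply: bmf_sum => k _; apply: bmfM; first exact: (bmf_past (br k)).
  exact/bmf_state/bmf_tent.
have bet k : bmf (fun o => e k (v o) * tent k (xi o)).
  by apply: bmfM; [exact: bmf_past|exact/bmf_state/bmf_tent].
have intUe k : bmf (fun o => U o * (e k (v o) * tent k (xi o))) by exact: bmfM.
have U_ge0 : 0 <= \int[P]_o `|U o| by exact: Rintegral_ge0.
have -> : \int[P]_o (U o * \sum_(k < L) c k (v o) * tent k (xi o)) =
    M * \int[P]_o (U o * \sum_(k < L) r (v o) k * tent k (xi o))
    - \sum_(k < L) \int[P]_o (U o * (e k (v o) * tent k (xi o))).
  rewrite -bint_sum// -bintZ; last exact: bmfM.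
  rewrite -bintB; [|apply: bmfZ; exact: bmfM|exact: bmf_sum].
  apply: eq_Rintegral => o _; rewrite -mulr_sumr mulrCA -mulrBr; congr (_ * _).
  rewrite mulr_sumr -sumrB; apply: eq_bigr => k _.
  by rewrite re mulrBl -mulrA.
rewrite (le_trans (ler_normB _ _))// lerD//.
  rewrite normrM (gtr0_norm M_gt0) ler_wpM2l//; first exact: ltW.
  rewrite -addrA; apply: (le_trans (@small_approx _ (fun x => eps + residual L x) _ wt g
    G%:R (ler0n _ G) bmix _ bwt _ _ _ _)).
  - by apply: bmfD; [exact: bmf_cst|exact: bmf_residual].
  - move=> y; rewrite (eq_bigr (fun s => wt s y)) ?sum_sign_weight// => s _.
    by rewrite ger0_norm// sign_weight_ge0.
  - by move=> s; case: (gP s).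
  - by move=> s y; case: (gP s).
  - move=> o; rewrite mixE -sumrB; apply: (le_trans (ler_norm_sum _ _ _)).
    rewrite -[leRHS]mul1r -(sum_sign_weight L (r (v o))) mulr_suml.
    apply: ler_sum => s _; rewrite -mulrBr normrM (ger0_norm (sign_weight_ge0 _ _))//.
    have [wt0|/wt_agree H] := eqVneq (wt s (v o)) 0.
      by rewrite -/(wt s (v o)) wt0 !mul0r.
    by rewrite ler_wpM2l ?sign_weight_ge0//; case: (gP s) => _ _; exact.
  - rewrite lerD2l (_ : (fun o => _) = (fun o => eps * `|U o| + `|U o| * residual L (xi o))).
      rewrite bintD; [|by apply: bmfZ; exact: bmf_norm|
        by apply: bmfM; [exact: bmf_norm|exact/bmf_state/bmf_residual]].
      rewrite bintZ; last exact: bmf_norm.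
      by rewrite lerD2r mulrC ler_wpM2r// ltW.
    by apply/funext => o; rewrite mulrDr mulrC.
apply: (le_trans (ler_norm_sum _ _ _)).
(* A single tent uses [small] with a one-element index type and the coefficient [e k / (2 * M)], of
   modulus at most 1. *)
have sum_unit (F : unit -> R) : \sum_i F i = F tt.
  by rewrite (bigD1 tt)//= big1 ?addr0// => -[].
have one k : (k < K)%N -> `|\int[P]_o (U o * (e k (v o) * tent k (xi o)))| <=
    2 * M * (C * eta + B * (eps / K.+1%:R)).
  move=> kK; have [gk [mgk gkC Hgk]] := HC k kK.
  have M2 : 0 < 2 * M by rewrite mulr_gt0.
  pose a (_ : unit) y := e k y / (2 * M).
  rewrite (_ : (fun o => _) = (fun o => 2 * M * (U o * (a tt (v o) * tent k (xi o))))); last first.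
    have ea o : e k (v o) = 2 * M * a tt (v o) by rewrite /a mulrC divfK// gt_eqF.
    by apply/funext => o; rewrite ea; ring.
  have bat : bmf (a tt : obs (borel Y) n -> R) by apply: bmfM => //; exact: bmf_cst.
  have ba : bmf (fun o => a tt (v o) * tent k (xi o)).
    by apply: bmfM; [exact: bmf_past|exact/bmf_state/bmf_tent].
  have a1 y : `|a tt y| <= 1.
    by rewrite /a normrM normfV (gtr0_norm M2) ler_pdivrMr// mul1r.
  rewrite bintZ; last exact: bmfM.
  rewrite normrM (gtr0_norm M2) ler_wpM2l//; first exact: ltW.
  apply: (le_trans (@small_approx _ (fun=> eps / K.+1%:R) unit a (fun=> gk) C C0 ba _ _ _ _ _ _)).
  - exact: bmf_cst.
  - by case.
  - by move=> y; rewrite sum_unit.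
  - by [].
  - by [].
  - move=> o; rewrite sum_unit -mulrBr normrM -[leRHS]mul1r.
    by rewrite ler_pM.
  - rewrite mulrC lerD2l; under eq_Rintegral do rewrite mulrC.
    rewrite bintZ; last exact: bmf_norm.
    by rewrite mulrC ler_wpM2r// divr_ge0// ltW.
apply: (@le_trans _ _ (\sum_(k < L) if (k < K)%N then
    2 * M * (C * eta + B * (eps / K.+1%:R)) else 0)).
  apply: ler_sum => k _; case: ifP => [/one//|kK].
  rewrite /e kK; under eq_Rintegral do rewrite mul0r mulr0.
  by rewrite bint_cst normr0.
rewrite -big_mkcond/= (big_ord_narrow KL) sumr_const card_ord -[leLHS]mulr_natl.
have B0 : 0 <= B by exact: le_trans UB.
have HK : K%:R * (eps / K.+1%:R) <= eps.
  by rewrite mulrCA ler_piMr ?(ltW eps0)// ler_pdivrMr// mul1r ler_nat.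
have -> : K%:R * (2 * M * (C * eta + B * (eps / K.+1%:R))) =
    2 * M * (K%:R * C * eta + B * (K%:R * (eps / K.+1%:R))) by ring.
apply: ler_wpM2l; first by rewrite mulr_ge0// ltW.
by rewrite lerD2l; exact: ler_wpM2l.
Qed.

End estimate.

End hump_estimate.

(** Dominated convergence; used to choose the rank [L] once everything else, n included, is
    fixed. *)
Lemma bint_eventually0 d (Om : measurableType d) (R : realType) (P : probability Om R)
    (g : nat -> Om -> R) : (forall L, bmf (g L)) -> (forall L o, 0 <= g L o <= 1) ->
  (forall o, exists L0, forall L, (L0 <= L)%N -> g L o = 0) ->
  forall delta, 0 < delta -> forall K, exists2 L, (K <= L)%N & \int[P]_o g L o <= delta.
Proof.
move=> bg g01 g0 delta delta0 K.
have cv : (\int[P]_o (g L o)%:E @[L --> \oo] --> 0)%E.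
  have -> : (0 = \int[P]_o (cst 0 o) :> \bar R)%E by rewrite integral0.
  apply: (@dominated_cvg _ _ _ P setT measurableT (fun L o => (g L o)%:E)
    (cst 0%E) (cst 1%E)) => //.
  - by move=> L; apply/measurable_EFinP; case: (bg L).
  - move=> o _; have [L0 HL0] := g0 o; apply: cvg_near_cst.
    by exists L0 => // L /= /HL0 ->.
  - have := @bmf_integrable _ _ _ P (fun=> 1) (bmf_cst _ _); exact.
  - by move=> L o _ /=; rewrite lee_fin ger0_norm; case/andP: (g01 L o).
have d0 : (0%:E < delta%:E :> \bar R)%E by rewrite lte_fin.
have [L0 _ HL0] := cv _ (open_ereal_lt' d0).
exists (maxn K L0); first exact: leq_maxl.
by have := HL0 (maxn K L0) (leq_maxr _ _); rewrite /= bmf_EFin// lte_fin => /ltW.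
Qed.

Section sign_of.
Context d (T : measurableType d) (R : realType) (D : T -> R).

Definition sign_of (x : T) : R := 2 * \1_[set y | 0 <= D y] x - 1.

Lemma sign_of_le1 x : `|sign_of x| <= 1.
Proof. by rewrite /sign_of indicE ler_norml; case: (x \in _) => /=; lra. Qed.

Lemma sign_ofM x : sign_of x * D x = `|D x|.
Proof.
rewrite /sign_of indicE; have [D0|D0] := leP 0 (D x).
  by rewrite mem_set//= ger0_norm//; lra.
by rewrite memNset /=; [rewrite ltr0_norm//; lra|apply/negP; rewrite -ltNge].
Qed.

Lemma bmf_sign_of : measurable_fun setT D -> bmf sign_of.
Proof.
move=> mD; apply: bmfB; last exact: bmf_cst.
apply/bmfZ/bmf_indic; rewrite -[X in measurable X]setTI.
have := mD measurableT _ (measurable_itv `[0, +oo[).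
by rewrite (_ : D @^-1` _ = [set y | 0 <= D y])//; apply/seteqP; split => y /=;
  rewrite in_itv/= andbT.
Qed.

End sign_of.

(** * The weight and its near orthogonality to observations *)

Section weighted.
Context (R : realType) (X Y Z : ptopologicalType).
Variables (T : R.-pker (borel X) ~> (borel X)) (Q : probability (borel Z) R).
Variable h : X -> Z -> Y.
Hypothesis mh : measurable_fun setT (fun p : borel X * borel Z => (h p.1 p.2 : borel Y)).
Context d (Om : measurableType d) (P : probability Om R) (nu : probability (borel X) R).
Variables (Xs : nat -> Om -> X) (Zs : nat -> Om -> Z).
Hypothesis proc : hmm_process T Q P nu Xs Zs.
Local Notation W := (obsseq h Xs Zs).
Variables (rho : borel X -> R) (m : nat) (Lam : (nat -> Y) -> R) (eta : R).
Hypothesis brho : bmf rho.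
Hypothesis bLam : bmf (Lam : obs (borel Y) m -> R).
Hypothesis proj : forall n (psi : (nat -> Y) -> R), (m <= n)%N ->
  measurable_fun setT (psi : obs (borel Y) n -> R) -> (forall v, `|psi v| <= 1) ->
  `|\int[P]_w ((rho (Xs 0%N w) - Lam (W w)) * psi (W w))| <= eta.

Definition weight w := rho (Xs 0%N w) - Lam (W w).

Let measurable_Xs i : measurable_fun setT (Xs i : Om -> borel X).
Proof. by case: proc. Qed.

Let bmf_obs n (a : (nat -> Y) -> R) : bmf (a : obs (borel Y) n -> R) -> bmf (fun w => a (W w)).
Proof.
by move=> ba; have := bmf_comp (@measurable_obsseq _ _ _ _ _ _ _ mh _ _ _ _ _ _ proc n) ba.
Qed.

Let bmf_Xs i (a : borel X -> R) : bmf a -> bmf (fun w => a (Xs i w)).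
Proof. by move=> ba; have := bmf_comp (@measurable_Xs i) ba. Qed.

Lemma bmf_weight : bmf weight.
Proof. exact: bmfB (bmf_Xs 0 brho) (bmf_obs bLam). Qed.

Lemma weight_small n (psi : (nat -> Y) -> R) C : (m <= n)%N -> 0 <= C ->
  measurable_fun setT (psi : obs (borel Y) n -> R) -> (forall v, `|psi v| <= C) ->
  `|\int[P]_w (weight w * psi (W w))| <= eta * C.
Proof.
move=> mn; rewrite le_eqVlt => /predU1P[<-|C0] mpsi psiC.
  rewrite mulr0 (_ : (fun w => _) = cst 0) ?bint_cst ?normr0//.
  apply/funext => w; have := psiC (W w).
  by rewrite normr_le0 => /eqP ->; rewrite mulr0.
have mpsi' : measurable_fun setT ((fun v => psi v / C) : obs (borel Y) n -> R).
  exact: measurable_funM.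
have := proj mn mpsi'; rewrite (_ : (fun w => _) =
    (fun w => C^-1 * (weight w * psi (W w)))); last first.
  by apply/funext => w; rewrite /weight; ring.
rewrite bintZ; last first.
  exact: bmfM bmf_weight (bmf_obs (bmf_le mpsi psiC)).
rewrite normrM normfV (gtr0_norm C0) mulrC ler_pdivrMr//; apply => v.
by rewrite normrM normfV (gtr0_norm C0) ler_pdivrMr// mul1r.
Qed.

(** Testing the weight against the sign of [Lam] bounds the mean of |Lam| by 1 + eta <= 2, and
    rho(X_0) has mean at most 1. A bound free of sup norms is essential: [rho] is chosen after the
    precision that this mass multiplies. *)
Lemma weight_norm_le : (forall x, 0 <= rho x) -> \int[nu]_x rho x <= 1 -> eta <= 1 ->
  \int[P]_w `|weight w| <= 3.
Proof.
move=> rho_ge0 rho1 eta1.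
have bLW := bmf_obs bLam; have brX := bmf_Xs 0 brho.
have Erho : \int[P]_w rho (Xs 0%N w) <= 1.
  apply: le_trans rho1.
  have := @hmm_law_start _ _ _ _ _ _ _ _ _ _ _ proc 0 rho (fun=> 1) brho (bmf_cst _ _).
  under eq_Rintegral do rewrite mulr1.
  by move=> ->; under eq_Rintegral do rewrite bint_K_cst mulr1.
have mL : measurable_fun setT (Lam : obs (borel Y) m -> R) by case: bLam.
pose s : obs (borel Y) m -> R := sign_of (Lam : obs (borel Y) m -> R).
have bs : bmf s by exact: bmf_sign_of.
have bsW := bmf_obs bs.
have s1 y : `|s y| <= 1 by exact: (@sign_of_le1 _ (obs (borel Y) m)).
have ELam : \int[P]_w `|Lam (W w)| <= 1 + eta.
  rewrite (_ : (fun w => _) = (fun w => rho (Xs 0%N w) * s (W w) - weight w * s (W w))).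
    rewrite bintB; [|exact: bmfM|by apply: bmfM => //; exact: bmf_weight].
    have : `|\int[P]_w (weight w * s (W w))| <= eta.
      by apply: (@proj m) => //; case: bs.
    have : \int[P]_w (rho (Xs 0%N w) * s (W w)) <= \int[P]_w rho (Xs 0%N w).
      apply: ler_bint => // [|w]; first exact: bmfM.
      by rewrite ler_piMr// (le_trans (ler_norm _)).
    by rewrite ler_norml; lra.
  apply/funext => w; rewrite -mulrBl /weight opprB addrC subrK mulrC.
  exact/esym/(sign_ofM (Lam : obs (borel Y) m -> R)).
apply: (@le_trans _ _ (\int[P]_w (rho (Xs 0%N w) + `|Lam (W w)|))).
  apply: ler_bint => [||w].
  - exact/bmf_norm/bmf_weight.
  - by apply: bmfD => //; exact: bmf_norm.
  by rewrite (le_trans (ler_normB _ _))// (ger0_norm (rho_ge0 _)).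
rewrite bintD//; last exact: bmf_norm.
lra.
Qed.

Variable n : nat.
Hypothesis mn : (m <= n.+1)%N.

Let bLam' : bmf (Lam : obs (borel Y) n.+1 -> R).
Proof. exact: bmf_obs_widen bLam. Qed.

(** Both halves have the form rho(X_0) a(Y) of the Markov lemmas, the missing factor being 1; [mn]
    makes [Lam] a function of the past. *)
Let split_weight (F : Om -> R) : bmf F -> \int[P]_w (weight w * F w) =
  \int[P]_w (rho (Xs 0%N w) * 1 * F w) - \int[P]_w (1 * Lam (W w) * F w).
Proof.
move=> bF; have bLW := bmf_obs bLam; have brX := bmf_Xs 0 brho.
rewrite -bintB; [|apply: bmfM => //; apply: bmfM => //; exact: bmf_cst..].
by apply: eq_Rintegral => w _; rewrite /weight; ring.
Qed.

Let b1X : bmf (fun _ : borel X => 1 : R). Proof. exact: bmf_cst. Qed.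
Let b1Y : bmf (fun _ : obs (borel Y) n.+1 => 1 : R). Proof. exact: bmf_cst. Qed.

Lemma weight_future N (a g : (nat -> Y) -> R) :
  bmf (a : obs (borel Y) n.+1 -> R) -> bmf (g : obs (borel Y) N -> R) ->
  \int[P]_w (weight w * (a (W w) * cond T Q h N g (Xs n.+1 w))) =
  \int[P]_w (weight w * (a (W w) * g (fun i => W w (n.+1 + i)%N))).
Proof.
move=> ba bg.
have bshift : bmf (fun w => g (fun i => W w (n.+1 + i)%N)).
  have ms : measurable_fun setT (fun w => (fun i => W w (n.+1 + i)%N) : obs (borel Y) N).
    apply: measurable_obs => i iN.
    have ni : (n.+1 + i < n.+1 + N)%N by rewrite ltn_add2l.
    exact: (measurableT_comp (measurable_obs_coord ni)
      (@measurable_obsseq _ _ _ _ _ _ _ mh _ _ _ _ _ _ proc (n.+1 + N))).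
  by have := bmf_comp ms bg.
have bcond := bmf_Xs n.+1 (bmf_cond T Q mh bg).
have baW := bmf_obs ba.
rewrite !split_weight; [|exact: bmfM..].
have fut r a' := @bint_future _ _ _ _ T Q h mh _ _ P nu Xs Zs proc n r a'.
congr (_ - _).
  have := fut _ _ brho ba N g bg; congr (_ = _); apply: eq_Rintegral => w _;
    by rewrite /cond; ring.
have := fut _ _ b1X (bmfM bLam' ba) N g bg; congr (_ = _); apply: eq_Rintegral => w _;
  by rewrite /cond; ring.
Qed.

Lemma weight_channel (s : (nat -> Y) -> R) (f : borel X -> R) :
  bmf (s : obs (borel Y) n.+2 -> R) -> bmf f ->
  \int[P]_w (weight w * (s (W w) * f (Xs n.+1 w))) =
  \int[P]_w (weight w * (f (Xs n.+1 w) *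
      \int[Q]_z s (splice n.+1 (W w) (fun=> h (Xs n.+1 w) z)))).
Proof.
move=> bs bf.
have bsW := bmf_obs bs; have bfX := bmf_Xs n.+1 bf.
have bint : bmf (fun w => \int[Q]_z s (splice n.+1 (W w) (fun=> h (Xs n.+1 w) z))).
  have ms : measurable_fun setT (fun p : Om * borel Z =>
      splice n.+1 (W p.1) (fun=> h (Xs n.+1 p.1) p.2) : obs (borel Y) n.+2).
    apply: measurable_obs => i ni; rewrite /splice; case: ltnP => ni'.
      exact: (measurableT_comp (measurable_obs_coord ni')
        (measurableT_comp (@measurable_obsseq _ _ _ _ _ _ _ mh _ _ _ _ _ _ proc n.+1)
           measurable_fst)).
    apply: (measurableT_comp mh (_ : measurable_fun setT
      (fun p : Om * borel Z => (Xs n.+1 p.1 : borel X, p.2)))).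
    apply: measurable_fun_pair => //.
    exact: (measurableT_comp (@measurable_Xs n.+1) measurable_fst).
  exact: (bmf_section_int (Q : giry _ R) (bmf_comp ms bs)).
rewrite !split_weight; [|exact: bmfM..].
have chan r a' := @bint_channel _ _ _ _ T Q h mh _ _ P nu Xs Zs proc n r a'.
congr (_ - _); first exact: (chan _ _ brho b1Y).
exact: (chan _ _ b1X bLam').
Qed.

(** Once conditional means are replaced by future observations, the weight is paired with a single
    function of [n.+1 + N] observations, bounded by [C] because the |a_i| sum to at most 1. *)
Lemma weight_small_future N (I : finType) (a g : I -> (nat -> Y) -> R) (C : R) : 0 <= C ->
  (forall i, bmf (a i : obs (borel Y) n.+1 -> R)) -> (forall y, \sum_i `|a i y| <= 1) ->
  (forall i, measurable_fun setT (g i : obs (borel Y) N -> R)) ->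
  (forall i y, `|g i y| <= C) ->
  `|\int[P]_w (weight w * \sum_i (a i (W w) * cond T Q h N (g i) (Xs n.+1 w)))| <= eta * C.
Proof.
move=> C0 ba a1 mg gC.
have bg i : bmf (g i : obs (borel Y) N -> R) by exact: (@bmf_le _ _ _ _ C).
pose psi y := \sum_i a i y * g i (fun k => y (n.+1 + k)%N).
have bpsi : bmf (psi : obs (borel Y) (n.+1 + N) -> R).
  apply: bmf_sum => i _; apply: bmfM; first exact: (bmf_obs_widen (leq_addr _ _) (ba i)).
  have ms : measurable_fun setT (fun y : obs (borel Y) (n.+1 + N) =>
      (fun k => y (n.+1 + k)%N) : obs (borel Y) N).
    apply: measurable_obs => k kN.
    have nk : (n.+1 + k < n.+1 + N)%N by rewrite ltn_add2l.
    exact: measurable_obs_coord nk.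
  by have := bmf_comp ms (bg i).
rewrite (_ : \int[P]_w _ = \int[P]_w (weight w * psi (W w))).
  apply: (@weight_small (n.+1 + N)) => //; first exact: leq_trans mn (leq_addr _ _).
    by case: bpsi.
  move=> y; apply: (le_trans (ler_norm_sum _ _ _)).
  apply: (@le_trans _ _ (\sum_i `|a i y| * C)).
    by apply: ler_sum => i _; rewrite normrM ler_wpM2l.
  by rewrite -mulr_suml ler_piMl.
have bterm i : bmf (fun w => a i (W w) * cond T Q h N (g i) (Xs n.+1 w)).
  exact: bmfM (bmf_obs (ba i)) (bmf_Xs n.+1 (bmf_cond T Q mh (bg i))).
have bshift i : bmf (fun w => a i (W w) * g i (fun k => W w (n.+1 + k)%N)).
  apply: (bmfM (bmf_obs (ba i))).
  have ms : measurable_fun setT (fun w => (fun k => W w (n.+1 + k)%N) : obs (borel Y) N).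
    apply: measurable_obs => k kN.
    have nk : (n.+1 + k < n.+1 + N)%N by rewrite ltn_add2l.
    exact: (measurableT_comp (measurable_obs_coord nk)
      (@measurable_obsseq _ _ _ _ _ _ _ mh _ _ _ _ _ _ proc (n.+1 + N))).
  by have := bmf_comp ms (bg i).
transitivity (\sum_i \int[P]_w (weight w * (a i (W w) * cond T Q h N (g i) (Xs n.+1 w)))).
  rewrite -bint_sum; last by move=> i _; apply: bmfM => //; exact: bmf_weight.
  by apply: eq_Rintegral => w _; rewrite mulr_sumr.
under eq_bigr do rewrite weight_future//.
rewrite -bint_sum; last by move=> i _; apply: bmfM => //; exact: bmf_weight.
by apply: eq_Rintegral => w _; rewrite /psi mulr_sumr.
Qed.

End weighted.

(** * Filter stability *)

Section stability.
Context (R : realType) (X Y Z : ptopologicalType).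
Hypothesis polishX : polish R X.
Variables (T : R.-pker (borel X) ~> (borel X)) (Q : probability (borel Z) R).
Variable h : X -> Z -> Y.
Hypothesis mh : measurable_fun setT (fun p : borel X * borel Z => (h p.1 p.2 : borel Y)).
Variables (mu nu : probability (borel X) R).
Hypothesis mu_ac_nu : mu `<< nu.
Context d1 (Om1 : measurableType d1) (P1 : probability Om1 R).
Variables (X1 : nat -> Om1 -> X) (Z1 : nat -> Om1 -> Z).
Hypothesis proc1 : hmm_process T Q P1 mu X1 Z1.
Context d2 (Om2 : measurableType d2) (P2 : probability Om2 R).
Variables (X2 : nat -> Om2 -> X) (Z2 : nat -> Om2 -> Z).
Hypothesis proc2 : hmm_process T Q P2 nu X2 Z2.
Local Notation W1 := (obsseq h X1 Z1).
Local Notation W2 := (obsseq h X2 Z2).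

(** Both processes are mixtures of the same trajectory kernel, so comparing them reduces to
    comparing [mu] with [rho] times [nu] on functions of the initial state. *)
Lemma change_of_start (rho : borel X -> R) eps C n (G : traj X Z n.+1 -> R) :
  bmf rho ->
  (forall (u : borel X -> R) C, measurable_fun setT u -> (forall x, `|u x| <= C) ->
     `|\int[mu]_x u x - \int[nu]_x (rho x * u x)| <= eps * C) ->
  measurable_fun setT G -> (forall s, `|G s| <= C) ->
  `|\int[P1]_w G (traj_of X1 Z1 w) - \int[P2]_w (rho (X2 0%N w) * G (traj_of X2 Z2 w))|
    <= eps * C.
Proof.
move=> brho close mG GC; have bG : bmf G by exact: bmf_le GC.
rewrite (hmm_law proc1 bG) (hmm_law_start proc2 brho bG).
apply: close; first by case: (bmf_gint (measurable_K T Q n.+1) bG).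
move=> x; rewrite -[leRHS](bint_K_cst T Q n.+1 x).
by apply: ler_norm_bint => //; exact: bmf_cst.
Qed.

Variables Fmu Fnu : nat -> (nat -> Y) -> probability (borel X) R.
Hypothesis filt_mu : is_filter h P1 X1 Z1 Fmu.
Hypothesis filt_nu : is_filter h P2 X2 Z2 Fnu.

(** With [s] the sign of the gap, the mu-filter turns into f(X) under P1, and the change of initial
    law moves this to P2 with the factor rho(X_0), at cost [eps * M]. The nu-filter term is moved
    likewise; there rho(X_0) is replaced by [Lam] at cost [eta * M], since [s] times the nu-filter
    is a function of the observations, and then the nu-filter turns into f(X). The difference
    carries rho(X_0) - Lam. *)
Lemma filter_gap (f : X -> R) M eps eta (rho : borel X -> R) m (Lam : (nat -> Y) -> R) n :
  measurable_fun setT (f : borel X -> R) -> (forall x, `|f x| <= M) ->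
  bmf rho -> bmf (Lam : obs (borel Y) m -> R) -> (m <= n.+1)%N ->
  (forall (u : borel X -> R) C, measurable_fun setT u -> (forall x, `|u x| <= C) ->
     `|\int[mu]_x u x - \int[nu]_x (rho x * u x)| <= eps * C) ->
  (forall n (psi : (nat -> Y) -> R), (m <= n)%N ->
    measurable_fun setT (psi : obs (borel Y) n -> R) -> (forall v, `|psi v| <= 1) ->
    `|\int[P2]_w ((rho (X2 0%N w) - Lam (W2 w)) * psi (W2 w))| <= eta) ->
  exists s : (nat -> Y) -> R, [/\ bmf (s : obs (borel Y) n.+2 -> R), (forall y, `|s y| <= 1) &
    \int[P1]_w `|\int[Fmu n.+1 (W1 w)]_x f x - \int[Fnu n.+1 (W1 w)]_x f x| <=
    2 * eps * M + eta * M +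
    \int[P2]_w (weight h X2 Z2 rho Lam w * (s (W2 w) * f (X2 n.+1 w)))].
Proof.
move=> mf fM brho bLam mn close proj.
have bf : bmf (f : borel X -> R) := bmf_le mf fM.
pose Imu (y : obs (borel Y) n.+2) := \int[Fmu n.+1 y]_x f x.
pose Inu (y : obs (borel Y) n.+2) := \int[Fnu n.+1 y]_x f x.
have bImu : bmf Imu.
  exact: (bmf_gint (measurable_filter filt_mu (n := n.+1)) bf).
have bInu : bmf Inu.
  exact: (bmf_gint (measurable_filter filt_nu (n := n.+1)) bf).
have InuM y : `|Inu y| <= M by exact: ler_norm_bintP.
have M_ge0 : 0 <= M by exact: le_trans (fM point).
pose s : obs (borel Y) n.+2 -> R := sign_of (fun y => Imu y - Inu y).
have bs : bmf s by apply: bmf_sign_of; case: (bmfB bImu bInu).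
have s1 y : `|s y| <= 1 by exact: (@sign_of_le1 _ (obs (borel Y) n.+2)).
have bobs1 (a : obs (borel Y) n.+2 -> R) : bmf a -> bmf (fun w => a (W1 w)).
  by move=> ba; have := bmf_comp (@measurable_obsseq _ _ _ _ _ _ _ mh _ _ _ _ _ _ proc1 n.+2) ba.
have bobs2 (a : obs (borel Y) n.+2 -> R) : bmf a -> bmf (fun w => a (W2 w)).
  by move=> ba; have := bmf_comp (@measurable_obsseq _ _ _ _ _ _ _ mh _ _ _ _ _ _ proc2 n.+2) ba.
have mX1 : measurable_fun setT (X1 n.+1 : Om1 -> borel X) by case: proc1.
have mX2 i : measurable_fun setT (X2 i : Om2 -> borel X) by case: proc2.
have bfX2 : bmf (fun w => f (X2 n.+1 w)) by have := bmf_comp (@mX2 n.+1) bf.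
have brX2 : bmf (fun w => rho (X2 0%N w)) by have := bmf_comp (@mX2 0%N) brho.
have bLam2 := bmf_obs_widen (leqW mn) bLam.
exists s; split => //.
have -> : \int[P1]_w `|\int[Fmu n.+1 (W1 w)]_x f x - \int[Fnu n.+1 (W1 w)]_x f x| =
    \int[P1]_w (s (W1 w) * Imu (W1 w)) - \int[P1]_w (s (W1 w) * Inu (W1 w)).
  have b1 : bmf (fun w => s (W1 w) * Imu (W1 w)) by have := bobs1 _ (bmfM bs bImu).
  have b2 : bmf (fun w => s (W1 w) * Inu (W1 w)) by have := bobs1 _ (bmfM bs bInu).
  rewrite -(bintB _ b1 b2); apply: eq_Rintegral => w _; rewrite -mulrBr.
  exact/esym/(@sign_ofM _ (obs (borel Y) n.+2) _ (fun y => Imu y - Inu y)).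
have bfst (a : obs (borel Y) n.+2 -> R) : bmf a ->
    bmf (fun p : obs (borel Y) n.+2 * borel X => a p.1).
  by move=> ba; have := bmf_comp (@measurable_fst _ _ (obs (borel Y) n.+2) (borel X)) ba.
have bsnd : bmf (fun p : obs (borel Y) n.+2 * borel X => f p.2).
  by have := bmf_comp (@measurable_snd _ _ (obs (borel Y) n.+2) (borel X)) bf.
have bsf : bmf (fun p : obs (borel Y) n.+2 * borel X => s p.1 * f p.2).
  exact: (bmfM (bfst _ bs) bsnd).
have fmu : \int[P1]_w (s (W1 w) * Imu (W1 w)) = \int[P1]_w (s (W1 w) * f (X1 n.+1 w)).
  have := bint_filter mh proc1 filt_mu bsf; rewrite /= => ->.
  by apply: eq_Rintegral => w _; rewrite bintZ.
have bLsf : bmf (fun p : obs (borel Y) n.+2 * borel X => Lam p.1 * s p.1 * f p.2).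
  exact: (bmfM (bfst _ (bmfM bLam2 bs)) bsnd).
have fnu : \int[P2]_w (Lam (W2 w) * (s (W2 w) * Inu (W2 w))) =
    \int[P2]_w (Lam (W2 w) * (s (W2 w) * f (X2 n.+1 w))).
  have := bint_filter mh proc2 filt_nu bLsf; rewrite /= => H.
  transitivity (\int[P2]_w (Lam (W2 w) * s (W2 w) * f (X2 n.+1 w))).
    by rewrite H; apply: eq_Rintegral => w _; rewrite bintZ// mulrA.
  by apply: eq_Rintegral => w _; rewrite mulrA.
have bymap k : (k <= n.+2)%N -> forall a : obs (borel Y) k -> R, bmf a ->
    bmf (fun t : traj X Z n.+2 => a (ymap h t)).
  by move=> kn a ba; have := bmf_comp (measurable_ymap mh kn) ba.
have tr1 : `|\int[P1]_w (s (W1 w) * f (X1 n.+1 w)) -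
    \int[P2]_w (rho (X2 0%N w) * (s (W2 w) * f (X2 n.+1 w)))| <= eps * M.
  apply: (@change_of_start rho eps M n.+1 (fun t => s (ymap h t) * f (t n.+1).1) brho close).
    have bft : bmf (fun t : traj X Z n.+2 => f (t n.+1).1).
      by have := bmf_comp (@measurable_state X Z n.+2 n.+1 (ltnSn _)) bf.
    by have [] := bmfM (bymap _ (leqnn _) _ bs) bft.
  by move=> t; rewrite normrM -[leRHS]mul1r ler_pM.
have tr2 : `|\int[P1]_w (s (W1 w) * Inu (W1 w)) -
    \int[P2]_w (rho (X2 0%N w) * (s (W2 w) * Inu (W2 w)))| <= eps * M.
  apply: (@change_of_start rho eps M n.+1 (fun t => s (ymap h t) * Inu (ymap h t)) brho close).
    by have [] := bymap _ (leqnn _) _ (bmfM bs bInu).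
  by move=> t; rewrite normrM -[leRHS]mul1r ler_pM.
have bsI := bmfM bs bInu.
have pr : `|\int[P2]_w (weight h X2 Z2 rho Lam w * (s (W2 w) * Inu (W2 w)))| <= eta * M.
  have := @weight_small _ _ _ _ T Q h mh _ _ P2 nu X2 Z2 proc2 rho m Lam eta brho bLam proj
    n.+2 (fun y => s y * Inu y) M (leqW mn) M_ge0.
  apply; first by case: bsI.
  by move=> y; rewrite normrM -[leRHS]mul1r ler_pM.
have wsplit (F : Om2 -> R) : bmf F -> \int[P2]_w (weight h X2 Z2 rho Lam w * F w) =
    \int[P2]_w (rho (X2 0%N w) * F w) - \int[P2]_w (Lam (W2 w) * F w).
  move=> bF; rewrite -bintB; [|exact: bmfM|exact: (bmfM (bobs2 _ bLam2) bF)].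
  by apply: eq_Rintegral => w _; rewrite /weight mulrBl.
move: pr; rewrite (wsplit _ (bobs2 _ bsI)) (wsplit _ (bmfM (bobs2 _ bs) bfX2)) fmu fnu.
move: tr1 tr2; rewrite !ler_norml => /andP[_ t1] /andP[t2 _] /andP[p1 p2].
lra.
Qed.

Hypothesis tvc : tv_continuous_channel Q h.
Hypothesis obsv : observable T Q h.

Lemma filter_stability (f : X -> R) M e : continuous f -> (forall x, `|f x| <= M) -> 0 < e ->
  exists n0, forall n, (n0 <= n)%N ->
  \int[P1]_w `|\int[Fmu n (W1 w)]_x f x - \int[Fnu n (W1 w)]_x f x| <= e.
Proof.
move=> cf fM0 e0.
pose M' := `|M| + 1.
have M1 : 1 <= M' by rewrite lerDr.
have M0 : 0 < M' by exact: lt_le_trans M1.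
have fM x : `|f x| <= M' by rewrite (le_trans (fM0 x))// (le_trans (ler_norm M))// lerDl.
have mf := continuous_measurable_borel cf; have bf := bmf_le mf fM.
(* 17 counts the errors [M' * eps]: 2 from the change of initial law, 3 + 6 from [hump_estimate], 3
   from the partition, 2 from the residual, 1 for all terms in [eta]. [M' >= 1] absorbs a bare
   [eps]. *)
pose eps := e / (17 * M').
have eps0 : 0 < eps by rewrite divr_gt0// mulr_gt0.
have [D [countD denseD]] := polishX.1.
have Fam0 : channel_family Q h f !=set0.
  eexists; exists (fun=> 0); split; [exact: measurable_cst| |reflexivity].
  by move=> y; rewrite normr0.
have [xs [w [w01 cw w_cover w_osc]]] := equicontinuous_partition
  (fun phi Fphi x => channel_family_le mh x fM Fphi)
  Fam0
  (fun x e e0 => channel_family_equicontinuous mh x polishX tvc cf fM e0)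
  countD denseD eps0.
have [N obsN] := observable_approx mh obsv.
have [K [c0 [G HG]]] := approximable_signed_sums obsN w01 cw w_cover eps0.
have epsK0 : 0 < eps / K.+1%:R by rewrite divr_gt0.
have [C [C0 HC]] := approximable_tents obsN w01 cw K epsK0.
have [rho [brho rho_ge0 rho1 close]] := bounded_density mu_ac_nu eps0.
(* Sum of the coefficients of [eta], up to the factor [M']: 1 from [filter_gap], [G] from the signed
   sums, 2 K C from the first [K] tents. *)
pose den := 1 + G%:R + 2 * (K%:R * C).
have den1 : 1 <= den by rewrite /den -addrA lerDl addr_ge0// ?mulr_ge0.
have den0 : 0 < den by exact: lt_le_trans den1.
pose eta := Num.min 1 (eps / den).
have eta0 : 0 < eta by rewrite lt_min ltr01 divr_gt0.
have eta1 : eta <= 1 by rewrite ge_min lexx.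
have etaden : eta * den <= eps by rewrite -ler_pdivlMr// ge_min lexx orbT.
have mX2 i : measurable_fun setT (X2 i : Om2 -> borel X) by case: proc2.
have brX2 : bmf (fun o => rho (X2 0%N o)) by have := bmf_comp (@mX2 0%N) brho.
have [m [Lam [bLam proj]]] :=
  near_projection P2 (measurable_obsseq mh proc2) brX2 eta0.
(* Beyond [m.+1] every index is a successor, as needed to restart at a positive time. *)
exists m.+1 => -[|n]; rewrite ?ltn0// ltnS => mn'.
have mn : (m <= n.+1)%N by exact: leqW.
have [s [bs s1 gap]] := filter_gap mf fM brho bLam mn close proj.
apply: (le_trans gap).
rewrite (weight_channel mh proc2 brho bLam mn bs bf).
pose U := weight h X2 Z2 rho Lam.
have bU : bmf U := bmf_weight mh proc2 brho bLam.
have UB : \int[P2]_o `|U o| <= 3 := weight_norm_le mh proc2 brho bLam proj rho_ge0 rho1 eta1.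
pose phi (y : nat -> Y) (x : X) := f x * \int[Q]_z s (splice n.+1 y (fun=> h x z)).
have msec y : measurable_fun setT (fun v : borel Y => s (splice n.+1 y (fun=> v))).
  have mv : measurable_fun setT (fun v : borel Y =>
      splice n.+1 y (fun=> v) : obs (borel Y) n.+2).
    by apply: measurable_obs => i ni; rewrite /splice; case: (i < n.+1)%N.
  by case: bs => ms _; exact: measurableT_comp ms mv.
have Fphi y : channel_family Q h f (phi y).
  by exists (fun v => s (splice n.+1 y (fun=> v))); split.
have phiM y x : `|phi y x| <= M' by exact: (channel_family_le mh x fM (Fphi y)).
have bsY2 : bmf (fun p : obs (borel Y) n.+1 * borel X =>
    \int[Q]_z s (splice n.+1 p.1 (fun=> h p.2 z))).
  have ms : measurable_fun setT (fun p : (obs (borel Y) n.+1 * borel X) * borel Z =>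
      splice n.+1 p.1.1 (fun=> h p.1.2 p.2) : obs (borel Y) n.+2).
    apply: measurable_obs => i ni; rewrite /splice; case: ltnP => ni'.
      exact: (measurableT_comp (measurable_obs_coord ni')
        (measurableT_comp measurable_fst measurable_fst)).
    apply: (measurableT_comp mh (_ : measurable_fun setT
      (fun p : (obs (borel Y) n.+1 * borel X) * borel Z => (p.1.2, p.2)))).
    by apply: measurable_fun_pair => //; exact: (measurableT_comp measurable_snd measurable_fst).
  exact: (bmf_section_int (Q : giry _ R) (bmf_comp ms bs)).
have bphi : bmf (fun p : obs (borel Y) n.+1 * borel X => phi p.1 p.2).
  apply: bmfM => //.
  by have := bmf_comp (@measurable_snd _ _ (obs (borel Y) n.+1) (borel X)) bf.
have mW2 := @measurable_obsseq _ _ _ _ _ _ _ mh _ _ _ _ _ _ proc2 n.+1.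
have mWX : measurable_fun setT (fun o => (W2 o : obs (borel Y) n.+1, X2 n.+1 o : borel X)).
  exact: measurable_fun_pair.
have bphiW : bmf (fun o => phi (W2 o) (X2 n.+1 o)) by have := bmf_comp mWX bphi.
pose c k (y : nat -> Y) := phi y (xs k).
have bc k : bmf (c k : obs (borel Y) n.+1 -> R).
  by have := bmf_comp (@pair2_measurable _ _ (obs (borel Y) n.+1) (borel X) (xs k)) bphi.
have bcW k : bmf (fun o => c k (W2 o)) by have := bmf_comp mW2 (bc k).
have bten k : bmf (fun o => tent w k (X2 n.+1 o)).
  by have := bmf_comp (@mX2 n.+1) (bmf_tent w01 cw k).
have bres L : bmf (fun o => residual w L (X2 n.+1 o)).
  by have := bmf_comp (@mX2 n.+1) (bmf_residual w01 cw L).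
(* This bound on the weight is not controlled; it only serves to choose [L] and does not enter the
   estimate. *)
have [BU BU0 UBU] : exists2 B, 0 < B & forall o, `|U o| <= B.
  case: bU => _ [B UB']; exists (`|B| + 1); first by rewrite ltr_wpDl.
  by move=> o; rewrite (le_trans (UB' o))// (le_trans (ler_norm B))// lerDl.
have [L KL HL] : exists2 L, (K <= L)%N &
    \int[P2]_o (`|U o| * residual w L (X2 n.+1 o)) <= eps.
  have [|||L KL HL] := @bint_eventually0 _ _ _ P2 (fun L o => residual w L (X2 n.+1 o)) bres
      _ _ (eps / BU) _ K.
  - by move=> L o; rewrite residual_ge0// residual_le1.
  - move=> o; have [L0 r0] := residual_cvg0 w_cover (X2 n.+1 o); exists L0 => L LL.
    apply/eqP; rewrite eq_le residual_ge0// andbT -[leRHS]r0.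
    exact: residual_le.
  - exact: divr_gt0.
  exists L => //; apply: (@le_trans _ _ (\int[P2]_o (BU * residual w L (X2 n.+1 o)))).
    apply: ler_bint => [||o].
    - by apply: bmfM => //; exact: bmf_norm.
    - exact: bmfZ.
    by rewrite ler_wpM2r// residual_ge0.
  by rewrite bintZ// mulrC -ler_pdivlMr.
set J := \int[P2]_o (`|U o| * residual w L (X2 n.+1 o)) in HL.
have small (I : finType) (a g : I -> (nat -> Y) -> R) (C' : R) := @weight_small_future
  _ _ _ _ T Q h mh _ _ P2 nu X2 Z2 proc2 rho m Lam eta brho bLam proj n mn N I a g C'.
have hump := @hump_estimate _ X Y Z T Q h mh N w w01 cw _ Om2 P2 U (X2 n.+1) n.+1 W2 3 eta M'
  bU UB (@mX2 n.+1) mW2 M0 small eps C K G L c0 c eps0 KL C0 HG HC bc (fun k y => phiM y (xs k)).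
pose S o := \sum_(k < L) c k (W2 o) * tent w k (X2 n.+1 o).
have bS : bmf S by apply: bmf_sum => k _; exact: bmfM.
have rest : `|\int[P2]_o (U o * (phi (W2 o) (X2 n.+1 o) - S o))| <= eps * 3 + M' * J.
  apply: (@le_trans _ _ (\int[P2]_o (eps * `|U o| + M' * (`|U o| * residual w L (X2 n.+1 o))))).
    apply: ler_norm_bint => [||o].
    - by apply: bmfM => //; exact: bmfB.
    - apply: bmfD; first exact/bmfZ/bmf_norm.
      by apply: bmfZ; apply: bmfM => //; exact: bmf_norm.
    rewrite normrM (_ : eps * _ + _ = `|U o| * (eps + M' * residual w L (X2 n.+1 o))); last by ring.
    rewrite ler_wpM2l//.
    apply: (@partition_approx _ _ w w01 (phi (W2 o)) xs eps M' L (X2 n.+1 o)) => //.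
      by move=> k; exact: w_osc.
    exact: ltW.
  rewrite bintD; [|exact/bmfZ/bmf_norm|by apply: bmfZ; apply: bmfM => //; exact: bmf_norm].
  rewrite !bintZ; [|by apply: bmfM => //; exact: bmf_norm|exact: bmf_norm].
  by rewrite lerD2r ler_wpM2l// ltW.
have total : \int[P2]_o (U o * phi (W2 o) (X2 n.+1 o)) =
    \int[P2]_o (U o * S o) + \int[P2]_o (U o * (phi (W2 o) (X2 n.+1 o) - S o)).
  rewrite -bintD; [|exact: bmfM|by apply: bmfM => //; exact: bmfB].
  by apply: eq_Rintegral => o _; rewrite -mulrDr addrC subrK.
rewrite -/U (_ : \int[P2]_w _ = \int[P2]_o (U o * phi (W2 o) (X2 n.+1 o)))//.
rewrite total.
have := le_trans (ler_norm _) hump; have := le_trans (ler_norm _) rest.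
rewrite -/J -/(S _) => H1 H2.
have eM : M' * eps * 17 = e by rewrite /eps; field; rewrite gt_eqF.
have etaden' : eta + eta * G%:R + 2 * (K%:R * C * eta) <= eps.
  by apply: le_trans etaden; rewrite /den; lra.
have H3 := ler_wpM2l (ltW M0) etaden'.
have H4 := ler_wpM2l (ltW M0) HL.
have H5 : eps <= M' * eps by rewrite ler_peMl// ltW.
rewrite -eM; move: H1 H2 H3 H4 H5.
rewrite /S; set A1 := \int[P2]_o _; set A2 := \int[P2]_o _.
lra.
Qed.

End stability.

Local Open Scope ereal_scope.

Theorem theorem8 (R : realType) (X Y Z : ptopologicalType)
  (polishX : polish R X) (polishY : polish R Y) (polishZ : polish R Z)
  (T : R.-pker (borel X) ~> (borel X)) (Q : probability (borel Z) R)
  (h : X -> Z -> Y)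
  (mh : measurable_fun setT (fun p : borel X * borel Z => (h p.1 p.2 : borel Y)))
  (mu nu : probability (borel X) R) (mu_ac_nu : mu `<< nu)
  (d1 : measure_display) (Om1 : measurableType d1) (P1 : probability Om1 R)
  (X1 : nat -> Om1 -> X) (Z1 : nat -> Om1 -> Z)
  (proc1 : hmm_process T Q P1 mu X1 Z1)
  (d2 : measure_display) (Om2 : measurableType d2) (P2 : probability Om2 R)
  (X2 : nat -> Om2 -> X) (Z2 : nat -> Om2 -> Z)
  (proc2 : hmm_process T Q P2 nu X2 Z2)
  (Fmu Fnu : nat -> (nat -> Y) -> probability (borel X) R)
  (filt_mu : is_filter h P1 X1 Z1 Fmu)
  (filt_nu : is_filter h P2 X2 Z2 Fnu)
  (tvc : tv_continuous_channel Q h)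
  (obsv : observable T Q h)
  (f : X -> R) (fcont : continuous f) (fbnd : exists M, forall x, (`|f x| <= M)%R) :
  (\int[P1]_w `| \int[Fmu n (obsseq h X1 Z1 w)]_x (f x)%:E
               - \int[Fnu n (obsseq h X1 Z1 w)]_x (f x)%:E |) @[n --> \oo] --> 0.
Proof.
have [M fM] := fbnd.
have bf : bmf (f : borel X -> R) := bmf_le (continuous_measurable_borel fcont) fM.
pose D n (y : obs (borel Y) n.+1) : R := (\int[Fmu n y]_x f x - \int[Fnu n y]_x f x)%R.
have bD n : bmf (@D n).
  apply: bmfB; [exact: (bmf_gint (measurable_filter filt_mu (n := n)) bf)|
    exact: (bmf_gint (measurable_filter filt_nu (n := n)) bf)].
pose r n : R := (\int[P1]_w `|D n (obsseq h X1 Z1 w)|)%R.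
rewrite (_ : (fun n => _) = (fun n => (r n)%:E)); last first.
  apply/funext => n; rewrite /r -bmf_EFin.
    by apply: eq_integral => w _; rewrite !bmf_EFin.
  have bDW := bmf_comp (@measurable_obsseq _ _ _ _ _ _ _ mh _ _ _ _ _ _ proc1 n.+1) (bD n).
  exact: bmf_norm bDW.
apply: cvg_EFin; first by near=> n.
apply/cvgrPdist_le => e e0.
have [n0 Hn0] := filter_stability polishX mh mu_ac_nu proc1 proc2 filt_mu filt_nu tvc obsv
  fcont fM e0.
exists n0 => // n /= n0n; rewrite sub0r normrN ger0_norm; first exact: Hn0.
exact: Rintegral_ge0.
Unshelve. all: by end_near.
Qed.
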